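(* Let $\eta,\sigma\in\{1,-1\}$, let $N\ge0$ be an integer, let $\epsilon\in\mathbb{R}\setminus\{0\}$, and let $\Gamma,T\in\mathbb{C}^{2(N+1)\times2(N+1)}$ be constant matrices satisfying $$\Gamma T+\sigma T\Gamma^*=0,\qquad TT^*=\begin{cases}-\eta I,&\sigma=1,\\ \eta\,|e^{\Gamma^*}|^2 I,&\sigma=-1.\end{cases}$$ Let $C^+\in\mathbb{C}^{2(N+1)}$ and $\Phi(n,t)=e^{\Gamma n+\frac{\epsilon}{4}(\coth\Gamma)\,t}\,C^+$ for $n\in\mathbb{Z}$, $t\in\mathbb{R}$. Define $$f=|e^{-N\Gamma}\Phi,\,e^{(-N+2)\Gamma}\Phi,\dots,e^{N\Gamma}\Phi;\ e^{N\Gamma}T\Phi^*_\sigma,\,e^{(N-2)\Gamma}T\Phi^*_\sigma,\dots,e^{-N\Gamma}T\Phi^*_\sigma|,$$ $$g=\tfrac1\epsilon|e^{-N\Gamma}\Phi,\,e^{(-N+2)\Gamma}\Phi,\dots,e^{(N+2)\Gamma}\Phi;\ e^{N\Gamma}T\Phi^*_\sigma,\,e^{(N-2)\Gamma}T\Phi^*_\sigma,\dots,e^{(-N+2)\Gamma}T\Phi^*_\sigma|,$$ and assume $f$ is nowhere zero on $\mathbb{Z}\times\mathbb{R}$. Then $$\mu=\frac gf,\qquad \omega=\epsilon^{-1}\ln(\widetilde f/f)$$ solve the complex local ($\sigma=1$) and nonlocal ($\sigma=-1$) semi-discrete sine-Gordon equation $$2(\widetilde\mu-\mu)'=\epsilon(\mu+\widetilde\mu)(1-2\omega'),\qquad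 e^{\epsilon(\omega-\underline{\omega})}-1=\eta\epsilon^2\mu\mu^*_\sigma .$$
   Context: For a function $F=F(n,t)$, $n\in\mathbb{Z}$, $t\in\mathbb{R}$: $\widetilde F=F(n+1,t)$, $\underline F=F(n-1,t)$, $F'=\partial_tF$, $F_\sigma=F(\sigma n,\sigma t)$. The asterisk denotes (entrywise) complex conjugation, without transposition; $F^*_\sigma$ is the complex conjugate of $F_\sigma$. $|e^{\Gamma^*}|$ is the determinant of $e^{\Gamma^*}$; $|a_0,\dots,a_p;b_0,\dots,b_q|$ is the determinant of the matrix with the listed columns in this order (in $g$ there are $N+2$ columns built from $\Phi$ and $N$ columns built from $T\Phi^*_\sigma$, the latter block being empty if $N=0$). $\coth\Gamma=(e^{2\Gamma}+I)(e^{2\Gamma}-I)^{-1}$, where $e^{2\Gamma}-I$ is assumed invertible. The logarithm is any branch that is differentiable in $t$, i.e. $\omega$ is differentiable in $t$ with $e^{\epsilon\omega}=\widetilde f/f$. *)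

(* Defs.v *)
From mathcomp Require Export all_boot all_order all_algebra.
From mathcomp Require Export complex.
From mathcomp Require Export all_classical all_reals all_analysis.

Set Implicit Arguments.
Unset Strict Implicit.
Unset Printing Implicit Defensive.

Import Order.TTheory GRing.Theory Num.Theory.
Import numFieldNormedType.Exports.
Local Open Scope classical_set_scope.
Local Open Scope ring_scope.
Local Open Scope complex_scope.

Definition cexp (R : realType) (z : R[i]) : R[i] :=
  let: x +i* y := z in (expR x * cos y) +i* (expR x * sin y).

(* The limit is taken in the topology of 'M[R[i]]_m as a normed module over   *)
(* R[i].                                                                      *)
Definition expm (R : realType) (m : nat) (A : 'M[R[i]]_m) : 'M[R[i]]_m :=
  limn (series (fun k : nat => (k`!%:R : R[i])^-1 *: A ^+ k)).

(* Junk value unless expm (2 *: A) - 1%:M is invertible.                      *)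
Definition cothm (R : realType) (m : nat) (A : 'M[R[i]]_m) : 'M[R[i]]_m :=
  (expm (2 *: A) + 1%:M) *m invmx (expm (2 *: A) - 1%:M).

(* Entrywise conjugation, without transposition.                              *)
Definition conj_mx (R : realType) (m p : nat) (A : 'M[R[i]]_(m, p)) :
    'M[R[i]]_(m, p) := map_mx (@conjc R) A.

(* R[i] is not a normed module over R in the libraries, so a complex function *)
(* of a real variable is differentiated through its real and imaginary parts. *)
Definition cderivable (R : realType) (F : R -> R[i]) (t : R) : Prop :=
  derivable (fun s => complex.Re (F s)) t 1 /\
  derivable (fun s => complex.Im (F s)) t 1.

Definition cderive (R : realType) (F : R -> R[i]) (t : R) : R[i] :=
  (derive1 (fun s => complex.Re (F s)) t) +i*
  (derive1 (fun s => complex.Im (F s)) t).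

(* |a_0, ..., a_(p-1); b_0, ..., b_(m-p-1)|; used only with p <= m.           *)
Definition det_cols (R : realType) (m p : nat) (a b : nat -> 'cV[R[i]]_m) :
    R[i] :=
  \det (\matrix_(i < m, j < m)
          (if (j < p)%N then a j i ord0 else b (j - p)%N i ord0)).

Definition Phi (R : realType) (m : nat) (eps : R) (Gamma : 'M[R[i]]_m)
    (Cp : 'cV[R[i]]_m) (n : int) (t : R) : 'cV[R[i]]_m :=
  expm (n%:~R *: Gamma + (eps / 4 * t)%:C *: cothm Gamma) *m Cp.

Definition TPhi (R : realType) (m : nat) (sigma : int) (eps : R)
    (Gamma T : 'M[R[i]]_m) (Cp : 'cV[R[i]]_m) (n : int) (t : R) :
    'cV[R[i]]_m :=
  T *m conj_mx (Phi eps Gamma Cp (sigma * n) (sigma%:~R * t)).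

Definition fsol (R : realType) (N : nat) (sigma : int) (eps : R)
    (Gamma T : 'M[R[i]]_(2 * N.+1)) (Cp : 'cV[R[i]]_(2 * N.+1))
    (n : int) (t : R) : R[i] :=
  det_cols N.+1
    (fun j => expm (((2 * j)%:Z - N%:Z)%:~R *: Gamma)
              *m Phi eps Gamma Cp n t)
    (fun j => expm ((N%:Z - (2 * j)%:Z)%:~R *: Gamma)
              *m TPhi sigma eps Gamma T Cp n t).

Definition gsol (R : realType) (N : nat) (sigma : int) (eps : R)
    (Gamma T : 'M[R[i]]_(2 * N.+1)) (Cp : 'cV[R[i]]_(2 * N.+1))
    (n : int) (t : R) : R[i] :=
  (eps%:C)^-1 *
  det_cols N.+2
    (fun j => expm (((2 * j)%:Z - N%:Z)%:~R *: Gamma)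
              *m Phi eps Gamma Cp n t)
    (fun j => expm ((N%:Z - (2 * j)%:Z)%:~R *: Gamma)
              *m TPhi sigma eps Gamma T Cp n t).

Definition solves_sdsG (R : realType) (eta sigma : int) (eps : R)
    (mu omega : int -> R -> R[i]) : Prop :=
  forall (n : int) (t : R),
  [/\ cderivable (mu n) t,
      cderivable (omega n) t,
      2 * cderive (fun s => mu (n + 1) s - mu n s) t
        = eps%:C * (mu n t + mu (n + 1) t) * (1 - 2 * cderive (omega n) t)
    & cexp (eps%:C * (omega n t - omega (n - 1) t)) - 1
        = eta%:~R * eps%:C ^+ 2 * mu n t
          * conjc (mu (sigma * n) (sigma%:~R * t))].

(* Main.v *)
(* With E = exp Gamma, the columns are a_j = E^(2j-N) Phi and                 *)
(* b_j = E^(N-2j) T Phi*_sigma.  The intertwining relation                    *)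
(* T Gamma* = - sigma Gamma T makes the b-columns evolve by the inverse flow  *)
(* of the a-columns: n -> n+1 multiplies a by E and b by E^-1, and d/dt       *)
(* multiplies them by +- (eps/4) coth Gamma.  Write X for the matrix of f and *)
(* beta for the coordinates of a_(N+1) in the columns of X.  By Cramer's      *)
(* rule eps mu, f~/f and eps mu~ are, up to sign and powers of det E, the     *)
(* last coordinate of beta, its first coordinate, and the quotient of its     *)
(* b_0-coordinate by the first one.  Differentiating X beta = a_(N+1) gives   *)
(*   beta' = (eps/2) (kappa beta + 2 L w)                                     *)
(* on these coordinates, where kappa = 2 for the first one and 1 otherwise,   *)
(* L is a scalar, and w are the coordinates of (E^2 - 1)^-1 a_1.              *)
(* The scalar L drops out of the first equation thanks to a Pluecker relation *)
(* between the coordinates of w and beta.                                     *)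
(* The second equation is the three-term Pluecker relation                    *)
(* f~ f_ - f^2 = (eps g) h, where h has N columns a and N+2 columns b, since  *)
(* multiplication by T maps the columns of f* and g* at (sigma n, sigma t),   *)
(* up to scalars, order and a common power of E, to those of f and h, so that *)
(* eps mu*_sigma = eta h / f.                                                 *)

Require Import Defs.
From mathcomp Require Import all_fingroup.
From mathcomp Require Import ring lra zify.

Set Implicit Arguments.
Unset Strict Implicit.
Unset Printing Implicit Defensive.

Import Order.TTheory GRing.Theory Num.Theory.
Import numFieldNormedType.Exports.
Local Open Scope ring_scope.
Local Open Scope complex_scope.

(** * Determinants of matrices given by their columns *)

(** Everything reduces to one family of determinants, [tau p n t], with [p] columns a and the
    remaining columns b: f is [tau N.+1], eps g is [tau N.+2], and the auxiliary h is [tau N]. The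
    reduction rests on [TPhiE]: moving [T] past the conjugated exponential reverses the flow.

    As f never vanishes, the columns of its matrix X form a basis, and each neighbouring determinant
    differs from f by one or two columns. So it is f times a coordinate (Cramer, [det_upd_cols]) or
    a 2x2 minor of coordinates ([det_upd2_cols]).

    The second equation follows from the bilinear identity [casorati_toda], once [tau_conj_ratio]
    has turned h / f into the conjugate of mu at the reflected point.

    For the first equation, coth Gamma = 1 + 2 (E^2 - 1)^-1. The vectors u_j = (E^2 - 1)^-1 a_j
    telescope, u_(j+1) - u_j = a_j, so they agree modulo a-columns; this is why one scalar L serves
    all three coordinates in [coord_derivative]. The relation [coord_mid] among the coordinates of
    u_1 then lets [riccati_sdsG] eliminate L. Only exp (eps omega) is ever used, so the choice of
    branch of the logarithm does not matter. *)

Section Columns.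
Context {F : comNzRingType} {m : nat}.
Implicit Types (s : nat -> 'cV[F]_m) (v : 'cV[F]_m).

Definition cols s : 'M[F]_m := \matrix_(i, j) s j i ord0.

Definition upd s (k : nat) v (j : nat) := if j == k then v else s j.

Lemma eq_cols s s' : (forall j, (j < m)%N -> s j = s' j) -> cols s = cols s'.
Proof. by move=> e; apply/matrixP => i j; rewrite !mxE e. Qed.

Lemma mulmx_cols (P : 'M[F]_m) s : P *m cols s = cols (fun j => P *m s j).
Proof.
by apply/matrixP => i j; rewrite !mxE; apply: eq_bigr => k _; rewrite mxE.
Qed.

Lemma cols_mulmx s v : cols s *m v = \sum_j v j ord0 *: s j.
Proof.
apply/colP => i; rewrite mxE summxE; apply: eq_bigr => j _.
by rewrite !mxE mulrC.
Qed.

Lemma det_upd s (k : 'I_m) v :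
  \det (cols (upd s k v)) = \sum_i v i ord0 * cofactor (cols s) i k.
Proof.
rewrite (expand_det_col _ k); apply: eq_bigr => i _.
rewrite mxE /upd eqxx; congr (_ * (_ * \det _)).
apply/matrixP => x y; rewrite !mxE.
by have /negbTE := neq_lift k y; rewrite eq_sym -val_eqE /= => ->.
Qed.

Lemma det_updD s (k : 'I_m) v v' :
  \det (cols (upd s k (v + v'))) =
  \det (cols (upd s k v)) + \det (cols (upd s k v')).
Proof.
by rewrite !det_upd -big_split; apply: eq_bigr => i _; rewrite mxE mulrDl.
Qed.

Lemma det_updZ s (k : 'I_m) c v :
  \det (cols (upd s k (c *: v))) = c * \det (cols (upd s k v)).
Proof.
by rewrite !det_upd mulr_sumr; apply: eq_bigr => i _; rewrite mxE mulrA.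
Qed.

(** Cramer's rule, read off from adj X X = det X. *)
Lemma det_upd_cols s (k : 'I_m) v :
  \det (cols (upd s k (cols s *m v))) = v k ord0 * \det (cols s).
Proof.
rewrite det_upd.
transitivity ((\adj (cols s) *m (cols s *m v)) k ord0).
  by rewrite [RHS]mxE; apply: eq_bigr => i _; rewrite [in RHS]mxE mulrC.
by rewrite mulmxA mul_adj_mx mul_scalar_mx mxE mulrC.
Qed.

Lemma det_cols_alternate s (j k : nat) :
  (j < m)%N -> (k < m)%N -> j != k -> s j = s k -> \det (cols s) = 0.
Proof.
move=> hj hk njk e; rewrite -det_tr.
apply: (@determinant_alternate _ _ _ (Ordinal hj) (Ordinal hk)) => // i.
by rewrite !mxE /= e.
Qed.

Lemma det_cols_swap s (j k : nat) : (j < m)%N -> (k < m)%N -> j != k ->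
  \det (cols (upd (upd s j (s k)) k (s j))) = - \det (cols s).
Proof.
move=> hj hk njk.
have -> : cols (upd (upd s j (s k)) k (s j)) =
          xcol (Ordinal hj) (Ordinal hk) (cols s).
  apply/matrixP => x y; rewrite !mxE /upd.
  case: tpermP => [->|->|]; rewrite /= ?eqxx //.
    by rewrite (negbTE njk).
  by move=> /eqP; rewrite -val_eqE /= => /negbTE -> /eqP;
     rewrite -val_eqE /= => /negbTE ->.
by rewrite xcolE det_mulmx det_perm odd_tperm -val_eqE /= njk expr1 mulrN1.
Qed.

(** The cyclic permutation that carries column [p] to position [q]; it is a product of [q - p]
    adjacent swaps, whence the sign in [det_slide]. *)
Definition slide s (p q : nat) (j : nat) :=
  if (j < p)%N || (q < j)%N then s j else if j == q then s p else s j.+1.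

Lemma det_slide s (p q : nat) : (p <= q)%N -> (q < m)%N ->
  \det (cols (slide s p q)) = (-1) ^+ (q - p) * \det (cols s).
Proof.
move=> /subnKC <-; set d := (q - p)%N; rewrite addKn.
elim: d => [|d ih] lt_m.
  rewrite addn0 mul1r; congr (\det _); apply: eq_cols => j _.
  rewrite /slide; case: ltngtP => //= [->//].
rewrite exprS -mulrA mulN1r -ih; last by lia.
rewrite -(@det_cols_swap _ (p + d) (p + d).+1); try lia.
congr (\det _); apply: eq_cols => j _.
rewrite /slide /upd addnS.
by do !case: ifP => //; try (move=> *; exfalso; lia); move=> *; congr s; lia.
Qed.

(** The two-column form of Cramer's rule, from which the Pluecker relations are drawn. *)
Lemma det_upd2_cols s (j k : 'I_m) v w : j != k ->
  \det (cols (upd (upd s j (cols s *m v)) k (cols s *m w))) =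
  (v j ord0 * w k ord0 - v k ord0 * w j ord0) * \det (cols s).
Proof.
move=> njk; have njk' : (j : nat) != k by [].
have updC (s' : nat -> 'cV[F]_m) x y :
    cols (upd (upd s' j x) k y) = cols (upd (upd s' k y) j x).
  apply: eq_cols => l _; rewrite /upd; case: eqP => // ->.
  by rewrite eq_sym (negbTE njk').
rewrite updC {1}(cols_mulmx s v).
have sumE (r : seq 'I_m) (u : nat -> 'cV[F]_m) :
    \det (cols (upd u j (\sum_(i <- r) v i ord0 *: s i))) =
    \sum_(i <- r) v i ord0 * \det (cols (upd u j (s i))).
  elim: r => [|i r ih]; last by rewrite !big_cons det_updD det_updZ ih.
  by rewrite !big_nil det_upd big1 // => i _; rewrite mxE mul0r.
(* In the expansion of column [j] only [s j] and [s k] survive: any other [s i] repeats a column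
   still present. *)
rewrite sumE (bigD1 j) //= (bigD1 k) 1?eq_sym //= big1 => [|i /andP[nij nik]].
  rewrite addr0 mulrBl -!mulrA -(det_upd_cols s k w) -mulrN; congr (_ * _ + _).
    congr (\det _); apply: eq_cols => l _; rewrite /upd.
    by case: eqP => // ->; rewrite (negbTE njk').
  rewrite -(det_upd_cols s j w) -(@det_cols_swap _ j k) //.
  congr (_ * \det _); apply: eq_cols => l _.
  rewrite /upd eqxx [k == j :> nat]eq_sym (negbTE njk').
  by case: eqP => [->|_]; [rewrite (negbTE njk') | case: eqP].
rewrite (@det_cols_alternate _ j i) ?mulr0 //; first by rewrite eq_sym.
by rewrite /upd eqxx !val_eqE (negbTE nij) (negbTE nik).
Qed.

Definition blk (p : nat) (a b : nat -> 'cV[F]_m) (j : nat) :=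
  if (j < p)%N then a j else b (j - p)%N.

Lemma eq_blk p a b a' b' :
    (forall j, (j < p)%N -> a j = a' j) ->
    (forall j, (j < m - p)%N -> b j = b' j) ->
  cols (blk p a b) = cols (blk p a' b').
Proof.
by move=> ea eb; apply: eq_cols => j hj; rewrite /blk; case: ltnP => h;
  [apply: ea | apply: eb; lia].
Qed.

Lemma mulmx_blk (P : 'M[F]_m) p a b :
  P *m cols (blk p a b) = cols (blk p (fun j => P *m a j) (fun j => P *m b j)).
Proof. by rewrite mulmx_cols; apply: eq_cols => j _; rewrite /blk; case: ifP. Qed.

Definition scons (x : 'cV[F]_m) (b : nat -> 'cV[F]_m) (j : nat) :=
  if j is k.+1 then b k else x.

Lemma det_blkZr p (c : F) a b :
  \det (cols (blk p a (fun j => c *: b j))) =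
  c ^+ (m - p) * \det (cols (blk p a b)).
Proof.
have -> : cols (blk p a (fun j => c *: b j)) =
  cols (blk p a b) *m diag_mx (\row_(j < m) (if (j < p)%N then 1 else c)).
  apply/matrixP => i j; rewrite mul_mx_diag !mxE /blk.
  by case: ltnP => _; rewrite ?mulr1 // mxE mulrC.
rewrite det_mulmx det_diag mulrC; congr (_ * _).
transitivity (\prod_(j < m) (if (j < p)%N then 1 else c)).
  by apply: eq_bigr => j _; rewrite mxE.
rewrite -(big_mkord xpredT (fun j => if (j < p)%N then 1 else c)).
have [lepm|ltmp] := leqP p m.
  rewrite (big_cat_nat (n:=p)) //= big_nat_cond big1 => [|j]; last first.
    by rewrite andbT => /andP[_ ->].
  rewrite mul1r big_nat_cond (eq_bigr (fun=> c)) => [|j].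
    by rewrite -big_nat_cond prodr_const_nat.
  by rewrite andbT => /andP[+ _]; rewrite ltnNge => ->.
rewrite (_ : m - p = 0)%N; last by lia.
by rewrite big_nat_cond big1 // => j /andP[/andP[_ lt_jm] _];
   rewrite (ltn_trans lt_jm ltmp).
Qed.

(* The sign is not evaluated: it cancels in the quotient g / f. *)
Lemma det_cols_rev s :
  \det (cols (fun j => s (m - j.+1)%N)) =
  (-1) ^+ perm (@rev_ord_inj m) * \det (cols s).
Proof.
rewrite mulrC -odd_permV -det_perm -det_mulmx -col_permE.
by congr (\det _); apply/matrixP => i j; rewrite !mxE permE.
Qed.

Lemma det_cols_rot s (k : nat) : (0 < m)%N -> ~~ odd m ->
  \det (cols (fun j => s ((j + k) %% m)%N)) = (-1) ^+ k * \det (cols s).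
Proof.
move=> m_gt0 m_even; elim: k => [|k ih].
  rewrite mul1r; congr (\det _); apply: eq_cols => j hj.
  by rewrite addn0 modn_small.
(* Rotation by one is a slide of the first column to the end; as [m] is even, it passes an odd
   number of columns. *)
have signm : (-1) ^+ (m.-1 - 0) = -1 :> F.
  rewrite subn0 -signr_odd.
  by case: m m_gt0 m_even => //= n _; rewrite negbK => ->.
rewrite exprS -mulrA -ih -signm -det_slide; try lia.
congr (\det _); apply: eq_cols => j hj; rewrite /slide /=.
rewrite ltnNge -ltnS prednK // hj /=; case: eqP => [->|_].
  by rewrite addnS -addSn prednK // modnDl.
by rewrite addnS addSn.
Qed.

Lemma det_blk_swap p a b : (0 < m)%N -> ~~ odd m -> (p <= m)%N ->
  \det (cols (blk (m - p) b a)) = (-1) ^+ p * \det (cols (blk p a b)).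
Proof.
move=> m_gt0 m_even lepm; rewrite -det_cols_rot //.
congr (\det _); apply: eq_cols => j hj; rewrite /blk.
have [h|h] := ltnP j (m - p).
  have jp : (j + p < m)%N by lia.
  by rewrite (modn_small jp) ltnNge leq_addl addnK.
have -> : (j + p = j - (m - p) + m)%N by lia.
have jp : (j - (m - p) < m)%N by lia.
rewrite modnDr (modn_small jp).
by case: ltnP => //; lia.
Qed.

End Columns.

(** * Neighbouring block determinants in coordinates *)

Section BlockDet.
Context {F : fieldType} {N : nat}.
Local Notation m := (2 * N.+1)%N.

Fact ord_first_proof : (0 < m)%N. Proof. by []. Qed.
Fact ord_mid_proof : (N.+1 < m)%N. Proof. lia. Qed.
Fact ord_last_proof : ((2 * N).+1 < m)%N. Proof. lia. Qed.
(** The positions in X of a_0, b_0 ([colN]) and b_N ([collast]), the only columns that get replaced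
    below. *)
Definition col0 : 'I_m := Ordinal ord_first_proof.
Definition colN : 'I_m := Ordinal ord_mid_proof.
Definition collast : 'I_m := Ordinal ord_last_proof.
Let h0 : col0 = 0%N :> nat. Proof. by []. Qed.
Let hN : colN = N.+1 :> nat. Proof. by []. Qed.
Let hl : collast = (2 * N).+1 :> nat. Proof. by []. Qed.

Implicit Types (a b s : nat -> 'cV[F]_m) (u v w : 'cV[F]_m).
Context {a b : nat -> 'cV[F]_m}.
Local Notation X := (cols (blk N.+1 a b)).

Let slide_first s : \det (cols (slide s 0 N)) = (-1) ^+ N * \det (cols s).
Proof. by rewrite det_slide ?subn0 //; lia. Qed.

Let slide_last s :
  \det (cols (slide s N.+1 (2 * N).+1)) = (-1) ^+ N * \det (cols s).
Proof.
rewrite det_slide; try lia.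
by have -> : ((2 * N).+1 - N.+1 = N)%N by lia.
Qed.

Local Ltac unfold_cols :=
  apply: congr1; apply: eq_cols; rewrite /slide /upd /blk ?h0 ?hN ?hl => j hj;
  rewrite /scons /=;
  do ![case: ifP => //=; try (move=> *; exfalso; lia)]; move=> *;
  try match goal with |- context [match ?k with 0 => _ | _ => _ end] =>
    let e := fresh in case e : k => [|?] end;
  try solve [exfalso; lia | done | (congr a || congr b); lia].

(** The new column a_(N+1) replaces a_0 and then slides past N columns to its place. The next lemmas
    follow the same pattern with b_0, b_N, or both a_0 and b_N replaced. *)
Lemma det_shift_left v : a N.+1 = X *m v ->
  \det (cols (blk N.+1 (a \o succn) b)) = (-1) ^+ N * (v col0 ord0 * \det X).
Proof.
move=> av; rewrite -(det_upd_cols _ col0) -av -slide_first.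
by unfold_cols.
Qed.

Lemma det_grow_left v : a N.+1 = X *m v ->
  \det (cols (blk N.+2 a b)) = (-1) ^+ N * (v collast ord0 * \det X).
Proof.
move=> av; rewrite -(det_upd_cols _ collast) -av.
apply: (canRL (signrMK N)); rewrite -slide_last.
by unfold_cols.
Qed.

Lemma det_mid u v : u = X *m v ->
  \det (cols (blk N.+1 a (scons u (b \o succn)))) = v colN ord0 * \det X.
Proof.
move=> uv; rewrite -(det_upd_cols _ colN) -uv.
by unfold_cols.
Qed.

Lemma det_shift_right u v : u = X *m v ->
  \det (cols (blk N.+1 a (scons u b))) = (-1) ^+ N * (v collast ord0 * \det X).
Proof.
move=> uv; rewrite -(det_upd_cols _ collast) -uv.
apply: (canRL (signrMK N)); rewrite -slide_last.
by unfold_cols.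
Qed.

Lemma det_shift_both u v w : a N.+1 = X *m v -> u = X *m w ->
  \det (cols (blk N.+1 (a \o succn) (scons u b))) =
  (v col0 ord0 * w collast ord0 - v collast ord0 * w col0 ord0) * \det X.
Proof.
move=> av uw; rewrite -det_upd2_cols; last by [].
rewrite -av -uw; apply: (can_inj (signrMK N)).
rewrite -slide_last -slide_first.
by unfold_cols.
Qed.

Lemma det_grow_right u v : u = X *m v ->
  \det (cols (blk N (a \o succn) (scons u b))) =
  (-1) ^+ N * (v col0 ord0 * \det X).
Proof.
move=> uv; rewrite -(det_upd_cols _ col0) -uv -slide_first.
by unfold_cols.
Qed.

Section Coordinates.
Context {u : nat -> 'cV[F]_m} (be w : 'cV[F]_m).
Hypothesis (a_u : forall j, a j = u j.+1 - u j).
Hypothesis (aX : a N.+1 = X *m be) (u1X : u 1 = X *m w).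
Hypothesis X_unit : X \in unitmx.

(** Multiplication by [A] (to be E^2) turns X with b_0 replaced by u_1 into a matrix in which a_0
    and b_N have been replaced, so a coordinate becomes a 2x2 minor. *)
Lemma det_shift_mid (A : 'M[F]_m) :
    (forall j, A *m u j = u j.+1) -> (forall j, A *m b j.+1 = b j) ->
  \det A * w colN ord0 = be col0 ord0 * w collast ord0 - be collast ord0 * w col0 ord0.
Proof.
move=> Au Ab; apply: (mulIf (x := \det X)).
  by rewrite -unitfE -unitmxE.
have Aa j : A *m a j = a j.+1 by rewrite !a_u mulmxBr !Au.
rewrite -mulrA -(det_mid u1X) -(det_shift_both aX u1X) -det_mulmx mulmx_blk.
set s := blk N.+1 (a \o succn) (scons 0 b).
have updE v : cols (blk N.+1 (a \o succn) (scons v b)) = cols (upd s colN v).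
  rewrite /s; apply: eq_cols; rewrite /upd /blk hN /scons => j _ /=.
  case: eqP => [->|/eqP nj]; first by rewrite ltnn subnn.
  by case: ifP => // hj; case e : (j - N.+1)%N => [|k] //; exfalso; lia.
(* [A] sends u_1 to u_2 = u_1 + a_1, and a_1 is already the first column of the shifted matrix. *)
transitivity (\det (cols (upd s colN (u 1 + a 1)))).
  congr (\det _); rewrite -updE.
  apply: eq_blk => [|[|j]] /= *; rewrite ?Aa ?Ab ?Au //.
  by rewrite a_u addrC subrK.
rewrite det_updD -updE [X in _ + X](@det_cols_alternate _ _ _ col0 colN) ?addr0 //.
by rewrite /upd eqxx.
Qed.

(* u j - u 1 is a sum of columns a_i with 1 <= i <= N (or - a 0 if j = 0),     *)
(* which have no coordinate of index k, so all u j contribute the same w k.   *)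
Lemma coord_derivative (kap : F) (K : 'M[F]_m) (be' : 'cV[F]_m) (k : 'I_m) :
    (forall j, K *m a j = a j + 2 *: u j) ->
    X *m be' +
      cols (blk N.+1 (fun j => kap *: (K *m a j)) (fun j => - kap *: (K *m b j)))
        *m be = kap *: (K *m a N.+1) ->
    (k == 0%N :> nat) || (N < k)%N ->
  be' k ord0 = 2 * kap * ((1 + (k == 0%N :> nat)%:R) * be k ord0 +
    2 * w k ord0 * (1 - \sum_(j < m | (j < N.+1)%N) be j ord0)).
Proof.
move=> Ka ode hk.
pose pr v : F := (invmx X *m v) k ord0.
have prX v : pr (X *m v) = v k ord0 by rewrite /pr mulKmx.
have prD v v' : pr (v + v') = pr v + pr v' by rewrite /pr mulmxDr mxE.
have prZ c v : pr (c *: v) = c * pr v by rewrite /pr -scalemxAr mxE.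
have prB v v' : pr (v - v') = pr v - pr v'.
  by rewrite -scaleN1r prD prZ mulN1r.
have pr_a j : (j < N.+1)%N -> pr (a j) = (k == j :> nat)%:R.
  move=> hj; have jm : (j < m)%N by lia.
  have -> : a j = X *m delta_mx (Ordinal jm) ord0.
    by rewrite -colE; apply/colP => i; rewrite !mxE /blk /= hj.
  by rewrite prX mxE eqxx andbT -val_eqE.
have pr_u j : (j <= N)%N -> pr (u j.+1) = w k ord0.
  elim: j => [|j ih] hj; first by rewrite u1X prX.
  have -> : u j.+2 = a j.+1 + u j.+1 by rewrite a_u subrK.
  rewrite prD ih ?(ltnW hj) // pr_a //.
  have -> : (k == j.+1 :> nat) = false by lia.
  by rewrite add0r.
have pr_u0 : pr (u 0) = w k ord0 - (k == 0%N :> nat)%:R.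
  have -> : u 0 = u 1 - a 0 by rewrite a_u subKr.
  by rewrite prB pr_u // pr_a.
(* Expanding [kap *: (K *m a N.+1)] in the columns of X and adding it to both sides cancels the
   b-columns, which carry the opposite sign, and doubles the a-columns. *)
have {ode} ode : X *m be' = (2 * kap) *: (K *m a N.+1) -
    \sum_(j < m | (j < N.+1)%N) (2 * kap * be j ord0) *: (K *m a j).
  have KX : kap *: (K *m a N.+1) =
      \sum_(j < m) be j ord0 *: (kap *: (K *m blk N.+1 a b j)).
    rewrite aX cols_mulmx mulmx_sumr scaler_sumr.
    by apply: eq_bigr => j _; rewrite -scalemxAr !scalerA mulrC.
  apply/eqP; rewrite -[X *m be'](addrK
    (cols (blk N.+1 (fun j => kap *: (K *m a j))
      (fun j => - kap *: (K *m b j))) *m be)) ode.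
  rewrite mulr_natl [kap *+ 2]mulr2n scalerDl -addrA (inj_eq (addrI _)).
  apply/eqP; rewrite cols_mulmx KX [X in _ - X]big_mkcond -sumrB -sumrN.
  apply: eq_bigr => j _; rewrite /blk.
  case: ifP => _; last by rewrite subr0 scaleNr scalerN opprK.
  by rewrite !scalerA -scalerBl -scaleNr; congr (_ *: _); ring.
rewrite -[LHS]prX ode prB prZ Ka prD prZ aX prX pr_u //.
have -> : pr (\sum_(j < m | (j < N.+1)%N) (2 * kap * be j ord0) *: (K *m a j)) =
    \sum_(j < m | (j < N.+1)%N)
      (2 * kap * be j ord0) * pr (K *m a j).
  rewrite /pr mulmx_sumr summxE; apply: eq_bigr => j _.
  by rewrite -scalemxAr mxE.
(* Only the term j = 0 is exceptional, because u_0 = u_1 - a_0; it yields the second copy of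
   [be k ord0] when k = 0. *)
have -> : \sum_(j < m | (j < N.+1)%N) (2 * kap * be j ord0) * pr (K *m a j) =
    \sum_(j < m | (j < N.+1)%N) (2 * kap * (2 * w k ord0)) * be j ord0
    - 2 * kap * (k == 0%N :> nat)%:R * be k ord0.
  rewrite (bigD1 col0) ?h0 //= [in RHS](bigD1 col0) ?h0 //=.
  rewrite Ka prD prZ pr_u0 pr_a //.
  rewrite (eq_bigr (fun j : 'I_m => 2 * kap * (2 * w k ord0) * be j ord0)).
    have [k0|_] := eqVneq (k : nat) 0%N; last by rewrite !mulr0n; ring.
    have -> : k = col0 by apply/val_inj; rewrite /= k0.
    by rewrite mulr1n; ring.
  move=> j /andP[hj j0]; have {}j0 : (j : nat) != 0%N.
    by apply: contra j0 => /eqP j0; apply/eqP/val_inj; rewrite /= j0.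
  rewrite Ka prD prZ pr_a // -[X in u X](prednK (n := j)) ?lt0n // pr_u; last lia.
  have -> : (k == j :> nat) = false by lia.
  by rewrite mulr0n; ring.
by rewrite -mulr_sumr; ring.
Qed.

End Coordinates.

End BlockDet.

(** * Double Casorati determinants and their bilinear relations *)

Section Casorati.
Context {F : fieldType} (N : nat).
Local Notation m := (2 * N.+1)%N.
Context (E : int -> 'M[F]_m) (al be : int -> 'cV[F]_m).
Hypothesis (E_al : forall x z, E x *m al z = al (x + z)).
Hypothesis (E_be : forall x z, E x *m be z = be (x + z)).
Hypothesis (E_unit : forall z, \det (E z) != 0).
Hypothesis (E2 : \det (E 2) = \det (E 1) ^+ 2).

Definition aseq (x : int) (j : nat) := al (x + (2 * j)%N%:Z).
Definition bseq (y : int) (j : nat) := be (y - (2 * j)%N%:Z).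

Definition casorati (p : nat) (x y : int) : F :=
  \det (cols (blk p (aseq x) (bseq y))).

Lemma casorati_shift p x y z :
  \det (E z) * casorati p x y = casorati p (x + z) (y + z).
Proof.
rewrite /casorati -det_mulmx mulmx_blk; congr (\det _).
apply: eq_blk => j _; rewrite /aseq /bseq ?E_al ?E_be.
  by congr al; ring.
by congr be; ring.
Qed.

(** Needed for sigma = 1, where conjugation followed by [T] exchanges the two blocks and keeps the
    order inside each. *)
Lemma casorati_swap (c : F) p x y : (p <= m)%N ->
  \det (cols (blk p (bseq y) (fun j => c *: aseq x j))) =
  (- c) ^+ (m - p) * casorati (m - p) x y.
Proof.
move=> lepm; rewrite det_blkZr exprNn [_ * c ^+ _]mulrC -mulrA; congr (_ * _).
rewrite -det_blk_swap //; try lia.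
by rewrite subKn.
Qed.

(** Needed for sigma = -1, where the order inside each block is reversed as well. Reversing all
    columns restores it, with a sign independent of [p]. *)
Lemma casorati_rev (c : F) p x y : (0 < p <= m)%N ->
  \det (cols (blk p (fun j => be (y + (2 * j)%N%:Z))
                    (fun j => c *: al (x - (2 * j)%N%:Z)))) =
  (-1) ^+ perm (@rev_ord_inj m) * (c ^+ (m - p) *
    casorati (m - p) (x - (2 * m)%N%:Z + (2 * p.+1)%N%:Z) (y + (2 * p.-1)%N%:Z)).
Proof.
move=> hp; rewrite det_blkZr mulrCA; congr (_ * _); apply: (canRL (signrMK _)).
rewrite -det_cols_rev; congr (\det _); apply: eq_cols => j hj.
rewrite /blk /aseq /bseq; have [h|h] := ltnP j (m - p).
  rewrite ifF; last by lia.
  by congr al; lia.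
rewrite ifT; last by lia.
by congr be; lia.
Qed.

Context (x y : int).
Local Notation X := (cols (blk N.+1 (aseq x) (bseq y))).
Hypothesis (f_neq0 : casorati N.+1 x y != 0).

Lemma casorati_unit : X \in unitmx.
Proof. by rewrite unitmxE unitfE. Qed.

Definition coord (v : 'cV[F]_m) := invmx X *m v.

Lemma coordK v : v = X *m coord v.
Proof. by rewrite /coord mulKVmx // casorati_unit. Qed.

Local Notation s := ((-1) ^+ N : F).
Local Notation f := (casorati N.+1 x y).
Local Notation bt := (coord (aseq x N.+1)).
Local Notation gm := (coord (be (y + 2))).
Local Notation dE := (\det (E 1)).

Let asucc z : cols (blk N.+1 (aseq (z + 2)) (bseq y)) =
  cols (blk N.+1 (aseq z \o succn) (bseq y)).
Proof. by apply: eq_blk => j _ //=; rewrite /aseq; congr al; lia. Qed.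

Lemma bseq_scons z j : bseq (z + 2) j = scons (be (z + 2)) (bseq z) j.
Proof. by case: j => [|j]; rewrite /bseq /=; congr be; lia. Qed.

(** A step in n moves both blocks in opposite directions; one more factor [E 1] returns the b-block
    to its place and leaves the a-block advanced by one column. *)
Lemma casorati_next : dE * casorati N.+1 (x + 1) (y - 1) = s * (bt col0 ord0 * f).
Proof.
rewrite casorati_shift addrK -addrA -(det_shift_left (coordK _)).
by rewrite /casorati asucc.
Qed.

Lemma casorati_grow : casorati N.+2 x y = s * (bt collast ord0 * f).
Proof. exact: (det_grow_left (coordK _)). Qed.

Lemma casorati_grow_next :
  casorati N.+2 (x + 1) (y - 1) = dE * (bt colN ord0 * f).
Proof.
rewrite -(det_mid (coordK _)).
have -> : casorati N.+2 (x + 1) (y - 1) = casorati N.+2 (x + 1) (y - 2 + 1).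
  by congr casorati; ring.
rewrite -casorati_shift; congr (_ * \det _).
apply: eq_cols => j hj; rewrite /blk ltnS; case: ltngtP => //= [h|->].
  have -> : (j - N.+1 = (j - N.+2).+1)%N by lia.
  by rewrite /= /bseq; congr be; lia.
by rewrite subnn.
Qed.

Lemma casorati_prev : casorati N.+1 x (y + 2) = s * (gm collast ord0 * f).
Proof.
rewrite -(det_shift_right (coordK _)).
by congr (\det _); apply: eq_blk => // j _; apply: bseq_scons.
Qed.

Lemma casorati_toda :
  casorati N.+1 (x + 1) (y - 1) * casorati N.+1 (x - 1) (y + 1) - f ^+ 2 =
  casorati N.+2 x y * casorati N x y.
Proof.
have h1 := casorati_next.
have h2 : dE * casorati N.+1 (x - 1) (y + 1) = s * (gm collast ord0 * f).
  by rewrite casorati_shift subrK -addrA casorati_prev.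
have h3 : dE ^+ 2 * f =
    (bt col0 ord0 * gm collast ord0 - bt collast ord0 * gm col0 ord0) * f.
  rewrite -E2 casorati_shift.
  rewrite -(det_shift_both (coordK _) (coordK _)).
  congr (\det _); apply: eq_blk => j _; last exact: bseq_scons.
  by rewrite /aseq /=; congr al; lia.
have h4 : dE ^+ 2 * casorati N x y = s * (gm col0 ord0 * f).
  rewrite -E2 casorati_shift -(det_grow_right (coordK _)).
  congr (\det _); apply: eq_blk => j _; last exact: bseq_scons.
  by rewrite /aseq /=; congr al; lia.
have ss : s * s = 1 by rewrite -exprD addnn -muln2 exprM sqrr_sign.
apply: (mulfI (expf_neq0 2 (E_unit 1))); rewrite casorati_grow.
move: h1 h2 h3 h4; move: (casorati N.+1 (x + 1) (y - 1)) (casorati N.+1 (x - 1) (y + 1))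
  (casorati N x y).
move=> f1 f2 h h1 h2 h3 h4.
(* By [h3] one factor f turns into a 2x2 minor; its first product cancels against [f1 * f2] and its
   second is the right-hand side. *)
have -> : dE ^+ 2 * (f1 * f2 - f ^+ 2) = dE * f1 * (dE * f2) - dE ^+ 2 * f * f.
  by ring.
rewrite h1 h2 h3 [RHS]mulrCA h4 ![s * _ * (s * _)]mulrACA ss.
by ring.
Qed.

Hypothesis Q_unit : E 2 - 1%:M \in unitmx.

Definition useq (j : nat) := invmx (E 2 - 1%:M) *m aseq x j.

Let E_aseq j : E 2 *m aseq x j = aseq x j.+1.
Proof. by rewrite /aseq E_al; congr al; lia. Qed.

Lemma aseq_useq j : aseq x j = useq j.+1 - useq j.
Proof.
rewrite /useq -mulmxBr -E_aseq -[X in _ *m (_ - X)]mul1mx -mulmxBl.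
by rewrite mulKmx.
Qed.

Lemma E_useq j : E 2 *m useq j = useq j.+1.
Proof.
have := mulKVmx Q_unit (aseq x j); rewrite -/(useq j) mulmxBl mul1mx aseq_useq.
by move=> /(congr1 (+%R^~ (useq j))); rewrite !subrK.
Qed.

Local Notation w := (coord (useq 1)).

Lemma coord_mid :
  dE ^+ 2 * w colN ord0 = bt col0 ord0 * w collast ord0 - bt collast ord0 * w col0 ord0.
Proof.
rewrite -E2; apply: (det_shift_mid aseq_useq (coordK _) (coordK _)).
- exact: casorati_unit.
- exact: E_useq.
- by move=> j; rewrite /bseq E_be; congr be; lia.
Qed.

Lemma coord_aseq_derivative (kap : F) (K : 'M[F]_m) (bt' : 'cV[F]_m) (k : 'I_m) :
    K = (E 2 + 1%:M) *m invmx (E 2 - 1%:M) ->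
    X *m bt' + cols (blk N.+1 (fun j => kap *: (K *m aseq x j))
                              (fun j => - kap *: (K *m bseq y j))) *m bt =
      kap *: (K *m aseq x N.+1) ->
    (k == 0%N :> nat) || (N < k)%N ->
  bt' k ord0 = 2 * kap * ((1 + (k == 0%N :> nat)%:R) * bt k ord0 +
    2 * w k ord0 * (1 - \sum_(j < m | (j < N.+1)%N) bt j ord0)).
Proof.
move=> KE; apply: (coord_derivative aseq_useq (coordK _) (coordK _)) => [|j].
  exact: casorati_unit.
rewrite KE -mulmxA -/(useq j) mulmxDl mul1mx E_useq.
rewrite -(subrK (useq j) (useq j.+1)) -aseq_useq -addrA scaler_nat.
by rewrite mulr2n.
Qed.

End Casorati.

(** * Scalar identities *)

(** Here [p], [q], [r] are the last, first and b_0-coordinates of a_(N+1), and [wp], [wq], [wr]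
    those of u_1. With [wr] eliminated, the terms in [L] on the left become a multiple of mu + mu~,
    matching the contribution of [L] to omega'. *)
Lemma riccati_sdsG (F : fieldType) (eps kap s D p q r wp wq wr L : F) :
    eps != 0 -> D != 0 -> q != 0 -> eps = 4 * kap ->
    D * wr = q * wp - p * wq ->
  let p' := 2 * kap * (p + 2 * wp * L) in
  let r' := 2 * kap * (r + 2 * wr * L) in
  let q' := 2 * kap * (2 * q + 2 * wq * L) in
  2 * (s * D / eps * ((r' * q - r * q') / q ^+ 2) - s / eps * p') =
  eps * (s / eps * p + s * D / eps * (r / q)) * (1 - 2 * (q' / q / eps)).
Proof.
move=> eps0 D0 q0 epsE wE p' r' q'.
have {wE} wE : wr = (q * wp - p * wq) / D by rewrite -wE mulrC mulKf.
have kap0 : kap != 0 by apply: contraNneq eps0; rewrite epsE => ->; rewrite mulr0.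
have four0 : 4 != 0 :> F by apply: contraNneq eps0; rewrite epsE => ->; rewrite mul0r.
rewrite /p' /q' /r' wE epsE.
by field; rewrite kap0 four0 q0 D0.
Qed.

(** Used with [d] the determinant of [T], which is nonzero because [k * f] is. *)
Lemma div_proportional (F : fieldType) (a k d f f' g' h : F) :
    k != 0 -> f != 0 -> d * f' = k * f -> d * g' = a * k * h ->
  g' / f' = a * (h / f).
Proof.
move=> k0 f0 e1 e2.
have d0 : d != 0.
  have : k * f != 0 by rewrite mulf_neq0.
  by rewrite -e1 mulf_eq0 negb_or => /andP[].
have -> : g' = a * k * h / d by rewrite -e2 mulrAC mulfV // mul1r.
have -> : f' = k * f / d by rewrite -e1 mulrAC mulfV // mul1r.
by field; rewrite f0 k0 d0.
Qed.

Lemma div_casorati (F : fieldType) (e s d f f1 g1 q r : F) :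
    e != 0 -> d != 0 -> f != 0 -> q != 0 -> s * s = 1 ->
    d * f1 = s * (q * f) -> g1 = d * (r * f) ->
  e^-1 * g1 / f1 = s * d ^+ 2 / e * (r / q).
Proof.
move=> e0 d0 f0 q0 ss e1 ->.
have s0 : s != 0.
  by apply/eqP => s0; move/eqP: ss; rewrite s0 mulr0 eq_sym oner_eq0.
have sV : s^-1 = s by apply: (mulfI s0); rewrite mulfV.
have -> : f1 = s * (q * f) / d by rewrite -e1 mulrAC mulfV // mul1r.
by rewrite -[s in RHS]sV; field; rewrite e0 d0 q0 f0 s0.
Qed.

Lemma div_next (F : fieldType) (s d f f1 q : F) :
    d != 0 -> f != 0 -> d * f1 = s * (q * f) -> f1 / f = s / d * q.
Proof.
move=> d0 f0 e1.
have -> : f1 = s * (q * f) / d by rewrite -e1 mulrAC mulfV // mul1r.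
by field; rewrite d0 f0.
Qed.

Lemma log_derivative (F : fieldType) (e c q q' w : F) :
  e != 0 -> c != 0 -> q != 0 -> e * w * (c * q) = c * q' -> q' / q / e = w.
Proof.
move=> e0 c0 q0 h.
have -> : q' = e * w * q by apply: (mulfI c0); rewrite -h; ring.
by field; rewrite e0 q0.
Qed.

Lemma div_toda (F : fieldType) (a e f f1 f2 g h : F) :
    e != 0 -> f != 0 -> f2 != 0 -> a * a = 1 -> f1 * f2 - f ^+ 2 = g * h ->
  f1 / f / (f / f2) - 1 = a * e ^+ 2 * (e^-1 * g / f) * (e^-1 * (a * (h / f))).
Proof.
move=> e0 f0 f20 aa toda.
have -> : f1 / f / (f / f2) - 1 = (f1 * f2 - f ^+ 2) / f ^+ 2.
  by field; rewrite f20 f0.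
rewrite toda -[LHS]mul1r -aa.
by field; rewrite e0 f0.
Qed.

(** * Complex-valued functions of a real variable *)

Local Notation Re := complex.Re.
Local Notation Im := complex.Im.

Section ReIm.
Local Open Scope classical_set_scope.
Local Open Scope ring_scope.
Context {R : realType}.
Implicit Types x y z : R[i].

Lemma ReD x y : Re (x + y) = Re x + Re y. Proof. by case: x y => ? ? []. Qed.
Lemma ImD x y : Im (x + y) = Im x + Im y. Proof. by case: x y => ? ? []. Qed.
Lemma ReM x y : Re (x * y) = Re x * Re y - Im x * Im y.
Proof. by case: x y => ? ? []. Qed.
Lemma ImM x y : Im (x * y) = Re x * Im y + Im x * Re y.
Proof. by case: x y => ? ? []. Qed.
Lemma ReV x : Re x^-1 = Re x / (Re x ^+ 2 + Im x ^+ 2).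
Proof. by case: x. Qed.
Lemma ImV x : Im x^-1 = - (Im x / (Re x ^+ 2 + Im x ^+ 2)).
Proof. by case: x. Qed.
Lemma eq_ReIm x y : Re x = Re y -> Im x = Im y -> x = y.
Proof. by case: x y => ? ? [? ?] /= -> ->. Qed.
Lemma Re_sum I (r : seq I) P (F : I -> R[i]) :
  Re (\sum_(i <- r | P i) F i) = \sum_(i <- r | P i) Re (F i).
Proof. by elim/big_rec2: _ => [|i x y _ <-]; rewrite ?ReD. Qed.
Lemma Im_sum I (r : seq I) P (F : I -> R[i]) :
  Im (\sum_(i <- r | P i) F i) = \sum_(i <- r | P i) Im (F i).
Proof. by elim/big_rec2: _ => [|i x y _ <-]; rewrite ?ImD. Qed.

(* Unlike `|z|, which lives in R[i], this norm is R-valued. *)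
Definition l1norm z : R := `|Re z| + `|Im z|.

Lemma l1normD x y : l1norm (x + y) <= l1norm x + l1norm y.
Proof.
by rewrite /l1norm ReD ImD addrACA lerD // ler_normD.
Qed.

Lemma l1normM x y : l1norm (x * y) <= l1norm x * l1norm y.
Proof.
rewrite /l1norm ReM ImM mulrDl !mulrDr -!normrM.
have h1 := ler_normB (Re x * Re y) (Im x * Im y).
have h2 := ler_normD (Re x * Im y) (Im x * Re y).
by apply: (le_trans (lerD h1 h2)); lra.
Qed.

Lemma l1norm_ge0 x : 0 <= l1norm x. Proof. exact: addr_ge0. Qed.

Lemma l1norm_sum I (r : seq I) P (F : I -> R[i]) :
  l1norm (\sum_(i <- r | P i) F i) <= \sum_(i <- r | P i) l1norm (F i).
Proof.
elim/big_rec2 : _ => [|i y x _ h]; first by rewrite /l1norm normr0 addr0.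
by apply: (le_trans (l1normD _ _)); rewrite lerD2l.
Qed.

Lemma normc_le_l1norm z : `|z| <= (l1norm z)%:C.
Proof.
rewrite normc_def lecR -[leRHS]ger0_norm ?l1norm_ge0 // -sqrtr_sqr.
apply: ler_wsqrtr; rewrite sqrrD !real_normK ?num_real //.
have := mulr_ge0 (normr_ge0 (Re z)) (normr_ge0 (Im z)); lra.
Qed.

End ReIm.

Lemma lim_mx_entries (K : numFieldType) m p (u : nat -> 'M[K]_(m, p))
    (L : 'M[K]_(m, p)) :
    (forall (e : K) i j, 0 < e ->
       (\forall n \near \oo, `|L i j - u n i j| < e)%classic) ->
  (limn u = L)%classic.
Proof.
move=> h; apply: cvg_lim; first exact: norm_hausdorff.
apply/cvg_ballP => e e_gt0.
have hfin : (\forall n \near \oo, forall ij : 'I_m * 'I_p,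
    `|L ij.1 ij.2 - u n ij.1 ij.2| < e)%classic.
  by apply: filter_forall => -[i j]; apply: h.
apply: filterS hfin => n hn; split=> // i j.
by rewrite -ball_normE; exact: (hn (i, j)).
Qed.

(** * Entrywise limits of complex matrices *)

Section EntrywiseLimit.
Local Open Scope classical_set_scope.
Local Open Scope ring_scope.
Context {R : realType}.

Definition ecvg m p (u : nat -> 'M[R[i]]_(m, p)) (L : 'M[R[i]]_(m, p)) :=
  forall i j, (fun n => Re (u n i j)) @ \oo --> Re (L i j) /\
              (fun n => Im (u n i j)) @ \oo --> Im (L i j).

Lemma ecvg_lim m p (u : nat -> 'M[R[i]]_(m, p)) L :
  ecvg u L -> limn (u : nat -> 'M[R[i] : numFieldType]_(m, p)) = L.
Proof.
move=> cu; apply: lim_mx_entries => e i j e_gt0.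
(* In the order of [R[i]], a positive element has zero imaginary part. *)
have [r r_gt0 ->] : exists2 r : R, 0 < r & e = r%:C.
  case: e e_gt0 => x y; rewrite ltcE /= => /andP[/eqP -> x_gt0].
  by exists x.
have r2 : 0 < r / 2 by rewrite divr_gt0.
have [/cvgrPdist_lt/(_ _ r2) h1 /cvgrPdist_lt/(_ _ r2) h2] := cu i j.
near=> n; rewrite (le_lt_trans (normc_le_l1norm _)) // ltcR /l1norm.
rewrite [ltRHS](splitr r) ltrD //.
  have : `|Re (L i j) - Re (u n i j)| < r / 2 by near: n.
  by case: (L i j) (u n i j) => ? ? [].
have : `|Im (L i j) - Im (u n i j)| < r / 2 by near: n.
by case: (L i j) (u n i j) => ? ? [].
Unshelve. all: by end_near. Qed.

Lemma ecvg_unique m p (u : nat -> 'M[R[i]]_(m, p)) L L' :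
  ecvg u L -> ecvg u L' -> L = L'.
Proof. by move=> /ecvg_lim <- /ecvg_lim <-. Qed.

Lemma ecvg_mull m p q (P : 'M[R[i]]_(q, m)) (u : nat -> 'M[R[i]]_(m, p)) L :
  ecvg u L -> ecvg (fun n => P *m u n) (P *m L).
Proof.
move=> cu i j; split.
  rewrite mxE Re_sum.
  rewrite (_ : (fun n => _) = (fun n => \sum_k Re (P i k * u n k j))).
    apply: cvg_big => [|k _]; first exact: add_continuous.
     rewrite ReM.
    under eq_fun do rewrite ReM.
    have [c1 c2] := cu k j.
    by apply: cvgB; apply: cvgMl_tmp.
  by apply/funext => n; rewrite mxE Re_sum.
rewrite mxE Im_sum.
rewrite (_ : (fun n => _) = (fun n => \sum_k Im (P i k * u n k j))).
  apply: cvg_big => [|k _]; first exact: add_continuous.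
     rewrite ImM.
  under eq_fun do rewrite ImM.
  have [c1 c2] := cu k j.
  by apply: cvgD; apply: cvgMl_tmp.
by apply/funext => n; rewrite mxE Im_sum.
Qed.

Lemma ecvg_tr m p (u : nat -> 'M[R[i]]_(m, p)) L :
  ecvg u L -> ecvg (fun n => (u n)^T) L^T.
Proof.
move=> cu i j; have [c1 c2] := cu j i.
by split; under eq_fun do rewrite mxE; rewrite mxE.
Qed.

Lemma ecvg_mulr m p q (P : 'M[R[i]]_(p, q)) (u : nat -> 'M[R[i]]_(m, p)) L :
  ecvg u L -> ecvg (fun n => u n *m P) (L *m P).
Proof.
move=> /ecvg_tr/(ecvg_mull P^T)/ecvg_tr.
rewrite trmx_mul !trmxK; congr (ecvg _ _).
by apply/funext => n; rewrite trmx_mul !trmxK.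
Qed.

Lemma ecvg_conj m p (u : nat -> 'M[R[i]]_(m, p)) L :
  ecvg u L -> ecvg (fun n => conj_mx (u n)) (conj_mx L).
Proof.
have ReJ (z : R[i]) : Re z^*%C = Re z by case: z.
have ImJ (z : R[i]) : Im z^*%C = - Im z by case: z.
move=> cu i j; have [c1 c2] := cu i j; rewrite mxE ReJ ImJ.
split; first by under eq_fun do rewrite mxE ReJ.
under eq_fun do rewrite mxE ImJ.
exact: cvgN.
Qed.

Lemma ecvg_cst_near m p (u : nat -> 'M[R[i]]_(m, p)) L N :
  (forall n, (N <= n)%N -> u n = L) -> ecvg u L.
Proof.
move=> e i j; split; apply: cvg_near_cst; near=> n; rewrite e //;
  by near: n; exact: nbhs_infty_ge.
Unshelve. all: by end_near. Qed.

End EntrywiseLimit.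

(** * Power series with exponentially bounded coefficients *)

Section ExpBounded.
Local Open Scope classical_set_scope.
Local Open Scope ring_scope.
Context {R : realType}.

(** A growth condition that gives convergence everywhere and is stable under termwise
    differentiation, as [pseries_snd_diffs] requires for two derivatives. *)
Definition exp_bounded (c : nat -> R) :=
  exists K M : R, 0 <= M /\ forall k, `|c k| <= K * (M ^+ k / k`!%:R).

Lemma exp_bounded_cvg c x : exp_bounded c -> cvgn (pseries c x).
Proof.
move=> [K [M [M0 bc]]]; apply: normed_cvg.
apply: (@series_le_cvg _ _ (fun k => K * exp_coeff (M * `|x|) k)) => [k|k|k|].
- exact: normr_ge0.
- rewrite mulr_ge0 ?exp_coeff_ge0 ?mulr_ge0 //.
  have := le_trans (normr_ge0 _) (bc 0%N).
  by rewrite expr0 divr1 mulr1.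
- rewrite /= normrM normrX /exp_coeff /= exprMn mulrAC mulrA.
  by rewrite ler_wpM2r ?exprn_ge0.
- exact: (is_cvg_seriesZ (k := K) (is_cvg_series_exp_coeff (M * `|x|))).
Qed.

Lemma exp_bounded_diffs c : exp_bounded c -> exp_bounded (pseries_diffs c).
Proof.
move=> [K [M [M0 bc]]]; exists (K * M), M; split=> // k.
rewrite /pseries_diffs normrM [`|k.+1%:R|]ger0_norm // (le_trans (ler_wpM2l _ (bc _))) //.
rewrite exprS factS natrM invfM le_eqVlt; apply/orP; left; apply/eqP.
have f0 : k`!%:R != 0 :> R by rewrite pnatr_eq0 -lt0n fact_gt0.
have k0 : k.+1%:R != 0 :> R by rewrite pnatr_eq0.
by field; rewrite f0 nat1r.
Qed.

Lemma exp_bounded_derive c (x : R) : exp_bounded c ->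
  is_derive x (1 : R) (fun y => limn (pseries c y)) (limn (pseries (pseries_diffs c) x)).
Proof.
move=> bc; apply: (@pseries_snd_diffs _ _ (`|x| + 1)).
- exact: exp_bounded_cvg.
- exact/exp_bounded_cvg/exp_bounded_diffs.
- exact/exp_bounded_cvg/exp_bounded_diffs/exp_bounded_diffs.
- by rewrite [ltRHS]ger0_norm ?addr_ge0 // ltrDl.
Qed.

End ExpBounded.

(** * Calculus of complex functions of a real variable *)

Section ComplexDerivative.
Context {R : realType}.

Definition is_cderive (F : R -> R[i]) (t : R) (d : R[i]) :=
  is_derive t 1 (fun s => Re (F s)) (Re d) /\
  is_derive t 1 (fun s => Im (F s)) (Im d).

Lemma is_cderive_val F t d : is_cderive F t d -> cderivable F t /\ cderive F t = d.
Proof.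
move=> [[d1 e1] [d2 e2]]; split; first exact: (conj d1 d2).
by rewrite /cderive !derive1E e1 e2; case: d {e1 e2}.
Qed.

Lemma cderivableP F t : cderivable F t -> is_cderive F t (cderive F t).
Proof.
move=> [d1 d2]; split; [apply: (DeriveDef d1) | apply: (DeriveDef d2)];
  by rewrite /cderive /= derive1E.
Qed.

Lemma is_cderive_unique F t d d' : is_cderive F t d -> is_cderive F t d' -> d = d'.
Proof. by move=> /is_cderive_val[_ <-] /is_cderive_val[_ <-]. Qed.

Lemma is_cderive_ext F G t d :
  (forall s, F s = G s) -> is_cderive F t d -> is_cderive G t d.
Proof. by move=> /funext ->. Qed.

Lemma is_cderive_cst z t : is_cderive (fun=> z) t 0.
Proof. by split; apply: is_derive_cst. Qed.

Lemma is_cderiveD F G t dF dG : is_cderive F t dF -> is_cderive G t dG ->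
  is_cderive (fun s => F s + G s) t (dF + dG).
Proof.
move=> [f1 f2] [g1 g2]; split.
  rewrite ReD (_ : (fun s => _) = (fun s => Re (F s)) \+ (fun s => Re (G s))).
    exact: is_deriveD.
  by apply/funext => s; rewrite ReD.
rewrite ImD (_ : (fun s => _) = (fun s => Im (F s)) \+ (fun s => Im (G s))).
  exact: is_deriveD.
by apply/funext => s; rewrite ImD.
Qed.

Lemma is_cderiveM F G t dF dG : is_cderive F t dF -> is_cderive G t dG ->
  is_cderive (fun s => F s * G s) t (dF * G t + F t * dG).
Proof.
move=> [f1 f2] [g1 g2]; split.
  have := is_deriveB (is_deriveM f1 g1) (is_deriveM f2 g2).
  rewrite (_ : _ - _ = fun s => Re (F s * G s)); last first.
    by apply/funext => s; rewrite ReM.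
  move=> /is_derive_eq; apply; rewrite ReD !ReM /GRing.scale /=; ring.
have := is_deriveD (is_deriveM f1 g2) (is_deriveM f2 g1).
rewrite (_ : _ + _ = fun s => Im (F s * G s)); last first.
  by apply/funext => s; rewrite ImM.
move=> /is_derive_eq; apply; rewrite ImD !ImM /GRing.scale /=; ring.
Qed.

(** Real calculus applied to 1 / z = conj z / |z|^2, with [n2] the squared modulus. *)
Lemma is_cderiveV F t dF : F t != 0 -> is_cderive F t dF ->
  is_cderive (fun s => (F s)^-1) t (- dF / F t ^+ 2).
Proof.
move=> Ft0 Fd; have [f1 f2] := Fd.
pose n2 s := Re (F s) ^+ 2 + Im (F s) ^+ 2.
have n20 : n2 t != 0.
  rewrite /n2 paddr_eq0 ?sqr_ge0 // !sqrf_eq0.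
  by apply: contra Ft0 => /andP[/eqP r0 /eqP col0]; apply/eqP/eq_ReIm.
have n2d : is_derive t 1 n2 (2 * (Re (F t) * Re dF + Im (F t) * Im dF)).
  have := is_deriveD (is_deriveM f1 f1) (is_deriveM f2 f2).
  by move=> /is_derive_eq; apply; rewrite /GRing.scale /=; ring.
have n2Vd := is_deriveV n20 n2d.
(* The squared modulus of [F t ^+ 2], a denominator created by the complex division in the stated
   derivative. *)
have n40 : (Re (F t) * Re (F t) + Im (F t) * - Im (F t)) ^+ 2 +
    (Re (F t) * Im (F t) + Im (F t) * Re (F t)) ^+ 2 != 0.
  by rewrite (_ : _ + _ = n2 t ^+ 2) ?expf_neq0 // /n2; ring.
split.
  rewrite (_ : (fun s => _) = (fun s => Re (F s)) * (fun s => (n2 s)^-1)).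
    apply: is_derive_eq (is_deriveM f1 n2Vd) _.
    rewrite expr2 ReM ReV ImV ReM ImM -mulrN /n2 /GRing.scale /=.
    by field; apply/andP; split; [exact n40 | exact n20].
  by apply/funext => s; rewrite ReV.
rewrite (_ : (fun s => _) = - ((fun s => Im (F s)) * (fun s => (n2 s)^-1))).
  apply: is_derive_eq (is_deriveN (is_deriveM f2 n2Vd)) _.
  rewrite expr2 ImM ReV ImV ReM ImM -mulrN /n2 /GRing.scale /=.
  by field; apply/andP; split; [rewrite -mulrN; exact n40 | exact n20].
by apply/funext => s; rewrite ImV.
Qed.

Lemma is_cderive_sum I (r : seq I) (P : pred I) (F : I -> R -> R[i]) t (d : I -> R[i]) :
    (forall i, P i -> is_cderive (F i) t (d i)) ->
  is_cderive (fun s => \sum_(i <- r | P i) F i s) t (\sum_(i <- r | P i) d i).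
Proof.
move=> Fd; elim: r => [|i r ih].
  rewrite big_nil; apply: is_cderive_ext (is_cderive_cst 0 t) => s.
  by rewrite big_nil.
rewrite big_cons; case: ifP => Pi; last first.
  by apply: is_cderive_ext ih => s; rewrite big_cons Pi.
apply: is_cderive_ext (is_cderiveD (Fd i Pi) ih) => s.
by rewrite big_cons Pi.
Qed.

Lemma is_cderiveZ z F t d : is_cderive F t d ->
  is_cderive (fun s => z * F s) t (z * d).
Proof.
by move=> /(is_cderiveM (is_cderive_cst z t)); rewrite mul0r add0r.
Qed.

Lemma is_cderive_div F G t dF dG :
    G t != 0 -> is_cderive F t dF -> is_cderive G t dG ->
  is_cderive (fun s => F s / G s) t ((dF * G t - F t * dG) / G t ^+ 2).
Proof.
move=> Gt0 Fd Gd; have := is_cderiveM Fd (is_cderiveV Gt0 Gd).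
by congr (is_cderive _ _ _); field.
Qed.

Lemma is_cderive0_cst F x y : (forall t, is_cderive F t 0) -> F x = F y.
Proof.
move=> Fd; apply: eq_ReIm.
  by apply: (@is_derive_0_is_cst _ (fun s => Re (F s))) => t; case: (Fd t).
by apply: (@is_derive_0_is_cst _ (fun s => Im (F s))) => t; case: (Fd t).
Qed.

Lemma is_cderive_cexp F t dF : is_cderive F t dF ->
  is_cderive (fun s => cexp (F s)) t (dF * cexp (F t)).
Proof.
have ReE z : Re (@cexp R z) = expR (Re z) * cos (Im z) by case: z.
have ImE z : Im (@cexp R z) = expR (Re z) * sin (Im z) by case: z.
move=> [f1 f2].
have he := is_derive1_comp (is_derive_expR (Re (F t))) f1.
have hc := is_derive1_comp (is_derive_cos (Im (F t))) f2.
have hs := is_derive1_comp (is_derive_sin (Im (F t))) f2.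
split.
  rewrite (_ : (fun s => _) = (expR \o (fun s => Re (F s))) *
    (cos \o (fun s => Im (F s)))); last by apply/funext => s; rewrite ReE.
  apply: is_derive_eq (is_deriveM he hc) _.
  by rewrite ReM ReE ImE /GRing.scale /=; ring.
rewrite (_ : (fun s => _) = (expR \o (fun s => Re (F s))) *
  (sin \o (fun s => Im (F s)))); last by apply/funext => s; rewrite ImE.
apply: is_derive_eq (is_deriveM he hs) _.
by rewrite ImM ReE ImE /GRing.scale /=; ring.
Qed.

Lemma cexpB (x y : R[i]) : cexp (x - y) = cexp x / cexp y.
Proof.
apply/(canRL (mulfK _)).
  case: y => a b; apply/eqP => -[/eqP + /eqP].
  rewrite !mulf_eq0 (gt_eqF (expR_gt0 a)) /= => /eqP c0 /eqP s0.
  have := cos2Dsin2 b.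
  by rewrite c0 s0 expr0n addr0 => /eqP; rewrite eq_sym oner_eq0.
case: x y => a b [c d]; rewrite /cexp /=.
rewrite expRD expRN cosD sinD cosN sinN.
have c0 : expR c != 0 by rewrite gt_eqF // expR_gt0.
have := cos2Dsin2 d => e.
apply: eq_ReIm => /=.
  by rewrite -[expR a * cos b]mulr1 -e; field.
by rewrite -[expR a * sin b]mulr1 -e; field.
Qed.

End ComplexDerivative.

(** * Calculus of matrix functions of a real variable *)

Section MatrixDerivative.
Context {R : realType}.

Definition is_mderive m p (X : R -> 'M[R[i]]_(m, p)) t (dX : 'M[R[i]]_(m, p)) :=
  forall i j, is_cderive (fun s => X s i j) t (dX i j).

Lemma is_mderive_ext m p (X Y : R -> 'M[R[i]]_(m, p)) t dX :
  (forall s, X s = Y s) -> is_mderive X t dX -> is_mderive Y t dX.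
Proof. by move=> /funext ->. Qed.

Lemma is_mderive_cst m p (A : 'M[R[i]]_(m, p)) t : is_mderive (fun=> A) t 0.
Proof. by move=> i j; rewrite mxE; apply: is_cderive_cst. Qed.

Lemma is_mderiveM m p q (X : R -> 'M[R[i]]_(m, p)) (Y : R -> 'M[R[i]]_(p, q))
    t dX dY : is_mderive X t dX -> is_mderive Y t dY ->
  is_mderive (fun s => X s *m Y s) t (dX *m Y t + X t *m dY).
Proof.
move=> Xd Yd i j; rewrite !mxE -big_split /=.
apply: is_cderive_ext (fun s => \sum_k X s i k * Y s k j) _ _ _ _ _.
  by move=> s; rewrite mxE.
by apply: is_cderive_sum => k _; apply: is_cderiveM.
Qed.

Lemma is_mderive_mull m p q (A : 'M[R[i]]_(m, p)) (Y : R -> 'M[R[i]]_(p, q))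
    t dY : is_mderive Y t dY -> is_mderive (fun s => A *m Y s) t (A *m dY).
Proof.
by move=> /(is_mderiveM (is_mderive_cst A t)); rewrite mul0mx add0r.
Qed.

Lemma is_mderive_mulr m p q (X : R -> 'M[R[i]]_(m, p)) (A : 'M[R[i]]_(p, q))
    t dX : is_mderive X t dX -> is_mderive (fun s => X s *m A) t (dX *m A).
Proof.
by move=> /is_mderiveM /(_ (is_mderive_cst A t)); rewrite mulmx0 addr0.
Qed.

Lemma is_mderive_unique m p (X : R -> 'M[R[i]]_(m, p)) t dX dX' :
  is_mderive X t dX -> is_mderive X t dX' -> dX = dX'.
Proof.
by move=> h h'; apply/matrixP => i j; apply: is_cderive_unique (h i j) (h' i j).
Qed.

Lemma is_mderive0_cst m p (X : R -> 'M[R[i]]_(m, p)) x y :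
  (forall t, is_mderive X t 0) -> X x = X y.
Proof.
move=> Xd; apply/matrixP => i j.
apply: (@is_cderive0_cst _ (fun s => X s i j)) => t.
by have := Xd t i j; rewrite mxE.
Qed.

Lemma cderive_det m (X : R -> 'M[R[i]]_m) t dX : is_mderive X t dX ->
  exists d, is_cderive (fun s => \det (X s)) t d.
Proof.
move=> Xd.
have prodP (I : Type) (r : seq I) (F : I -> R -> R[i]) :
    (forall i, exists d, is_cderive (F i) t d) ->
    exists d, is_cderive (fun s => \prod_(i <- r) F i s) t d.
  move=> Fd; elim: r => [|i r [d ih]].
    exists 0; apply: is_cderive_ext (is_cderive_cst 1 t) => s.
    by rewrite big_nil.
  have [di hi] := Fd i; eexists.
  apply: is_cderive_ext (is_cderiveM hi ih) => s.
  by rewrite big_cons.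
have {}prodP (s : 'S_m) : exists d, is_cderive (fun x => \prod_i X x i (s i)) t d.
  by apply: prodP => i; exists (dX i (s i)); apply: Xd.
pose d s := sval (cid (prodP s)).
exists (\sum_(s : 'S_m) (-1) ^+ s * d s).
by apply: is_cderive_sum => s _; apply/is_cderiveZ/(svalP (cid (prodP s))).
Qed.

(** Existence suffices: it makes the coordinates differentiable, and their derivative is then found
    by differentiating a linear system. *)
Lemma mderive_invmx m (X : R -> 'M[R[i]]_m) t dX :
    (forall s, X s \in unitmx) -> is_mderive X t dX ->
  exists dY, is_mderive (fun s => invmx (X s)) t dY.
Proof.
move=> Xu Xd; have [d0 hd0] := cderive_det Xd.
have Xdet0 : \det (X t) != 0 by have := Xu t; rewrite unitmxE unitfE.
have cofd i j : exists d, is_cderive (fun s => cofactor (X s) j i) t d.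
  have [|d hd] := @cderive_det _ (fun s => row' j (col' i (X s))) t
    (row' j (col' i dX)).
    by move=> k l; rewrite !mxE; apply: is_cderive_ext (Xd _ _) => s; rewrite !mxE.
  by eexists; apply: is_cderiveZ hd.
have entry i j : exists d, is_cderive (fun s => invmx (X s) i j) t d.
  have [d hd] := cofd i j; eexists.
  apply: is_cderive_ext (is_cderiveM (is_cderiveV Xdet0 hd0) hd) => s.
  by rewrite /invmx Xu !mxE.
exists (\matrix_(i, j) sval (cid (entry i j))) => i j.
by rewrite mxE; apply: (svalP (cid (entry i j))).
Qed.

End MatrixDerivative.

(** * The matrix exponential *)

Section MatrixExponential.
Context {R : realType} {m : nat}.
Implicit Types A B P : 'M[R[i]]_m.

Definition expm_sum A (n : nat) : 'M[R[i]]_m :=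
  \sum_(0 <= k < n) (k`!%:R)^-1 *: A ^+ k.

(** The witness is the sum of the norms of all entries, which dominates every row sum. *)
Lemma l1norm_powmx A : exists M : R, 0 <= M /\
  forall k i j, l1norm ((A ^+ k) i j) <= M ^+ k.
Proof.
pose c := \sum_i \sum_j l1norm (A i j).
have c0 : 0 <= c by rewrite sumr_ge0 // => i _; rewrite sumr_ge0 // => j _; exact: l1norm_ge0.
exists c; split=> //; elim=> [|k ih] i j.
  rewrite expr0 mxE; case: (i == j); rewrite /l1norm /=.
    by rewrite normr1 normr0 addr0.
  by rewrite normr0 addr0.
rewrite exprS mxE (le_trans (l1norm_sum _ _ _)) //.
apply: (@le_trans _ _ (\sum_l l1norm (A i l) * c ^+ k)).
  apply: ler_sum => l _; apply: (le_trans (l1normM _ _)).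
  by rewrite ler_wpM2l ?l1norm_ge0.
rewrite -mulr_suml exprS ler_wpM2r ?exprn_ge0 // /c [leRHS](bigD1 i) //= lerDl.
by rewrite sumr_ge0 // => x _; rewrite sumr_ge0 // => y _; exact: l1norm_ge0.
Qed.

Definition re_coef A i j (k : nat) : R := Re ((A ^+ k) i j) / k`!%:R.
Definition im_coef A i j (k : nat) : R := Im ((A ^+ k) i j) / k`!%:R.

Lemma coef_exp_bounded A i j :
  exp_bounded (re_coef A i j) /\ exp_bounded (im_coef A i j).
Proof.
have [M [M0 hM]] := l1norm_powmx A.
have f0 k : 0 <= (k`!%:R : R)^-1 by rewrite invr_ge0.
split; exists 1, M; split=> // k; rewrite mul1r normrM (ger0_norm (f0 k));
  rewrite ler_wpM2r // (le_trans _ (hM k i j)) //.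
  by rewrite lerDl.
by rewrite lerDr.
Qed.

Lemma factV_real k : (k`!%:R : R[i])^-1 = ((k`!%:R : R)^-1)%:C.
Proof. by rewrite fmorphV rmorph_nat. Qed.

Lemma Re_realM (x : R) z : Re (x%:C * z) = x * Re z.
Proof. by case: z => a b; rewrite /= mul0r subr0. Qed.
Lemma Im_realM (x : R) z : Im (x%:C * z) = x * Im z.
Proof. by case: z => a b; rewrite /= mul0r addr0. Qed.

Lemma exprZmx (x : R) A k : (x%:C *: A) ^+ k = (x ^+ k)%:C *: A ^+ k.
Proof.
elim: k => [|k ih]; first by rewrite !expr0 scale1r.
rewrite !exprS ih -[_ * _]/(_ *m _) -scalemxAl -scalemxAr scalerA.
by rewrite rmorphM.
Qed.

Lemma expm_sum_pseries A (x : R) n i j :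
  Re (expm_sum (x%:C *: A) n i j) = pseries (re_coef A i j) x n /\
  Im (expm_sum (x%:C *: A) n i j) = pseries (im_coef A i j) x n.
Proof.
rewrite /expm_sum summxE Re_sum Im_sum.
by split; apply: eq_bigr => k _; rewrite exprZmx !mxE factV_real mulrA -rmorphM
  ?Re_realM ?Im_realM /= /re_coef /im_coef; ring.
Qed.

Definition expm_entries A (x : R) : 'M[R[i]]_m :=
  \matrix_(i, j) ((limn (pseries (re_coef A i j) x))%classic +i*
                  (limn (pseries (im_coef A i j) x))%classic).

Lemma expm_entriesP A (x : R) : ecvg (expm_sum (x%:C *: A)) (expm_entries A x).
Proof.
move=> i j; have [bRe bIm] := coef_exp_bounded A i j.
rewrite mxE /=; split.
  under eq_fun do rewrite (expm_sum_pseries A x _ i j).1.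
  exact: exp_bounded_cvg.
under eq_fun do rewrite (expm_sum_pseries A x _ i j).2.
exact: exp_bounded_cvg.
Qed.

Lemma expmE A : expm A = expm_entries A 1.
Proof. by rewrite -(ecvg_lim (expm_entriesP A 1)) scale1r. Qed.

Lemma expm_cvg A : ecvg (expm_sum A) (expm A).
Proof. by have := expm_entriesP A 1; rewrite -expmE scale1r. Qed.

Lemma expmZE A x : expm (x%:C *: A) = expm_entries A x.
Proof. exact: ecvg_unique (expm_cvg _) (expm_entriesP A x). Qed.

(** Each power of [A] passes through [P], hence so does the limit. This serves both for commutation
    and for moving [T] past exponentials. *)
Lemma expm_intertwine A B P : A *m P = P *m B -> expm A *m P = P *m expm B.
Proof.
move=> AP; apply: ecvg_unique (ecvg_mulr P (expm_cvg A)) _.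
have := ecvg_mull P (expm_cvg B); congr (ecvg _ _); apply/funext => n.
rewrite /expm_sum mulmx_sumr mulmx_suml; apply: eq_bigr => k _.
rewrite -scalemxAl -scalemxAr; congr (_ *: _).
elim: k => [|k ih]; first by rewrite mulmx1 mul1mx.
rewrite exprSr exprSr -[A ^+ k * A]/(A ^+ k *m A) -[B ^+ k * B]/(B ^+ k *m B).
by rewrite [LHS]mulmxA ih -[LHS]mulmxA -AP [LHS]mulmxA.
Qed.

Lemma expm_conj A : conj_mx (expm A) = expm (conj_mx A).
Proof.
apply: ecvg_unique (ecvg_conj (expm_cvg A)) _.
have := expm_cvg (conj_mx A); congr (ecvg _ _); apply/funext => n.
rewrite /conj_mx /expm_sum raddf_sum; apply: eq_bigr => k _.
rewrite /= map_mxZ fmorphV rmorph_nat; congr (_ *: _).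
by rewrite rmorphXn.
Qed.

Lemma expm0 : expm (0 : 'M[R[i]]_m) = 1%:M.
Proof.
apply: ecvg_unique (expm_cvg 0) _.
apply: (@ecvg_cst_near _ _ _ _ _ 1%N) => -[//|n] _.
rewrite /expm_sum big_nat_recl // big1 ?addr0 => [|k _].
  by rewrite fact0 invr1 scale1r.
by rewrite expr0n scaler0.
Qed.

Lemma expm_derive A t : is_mderive (fun x => expm (x%:C *: A)) t (A *m expm (t%:C *: A)).
Proof.
move=> i j; have [bRe bIm] := coef_exp_bounded A i j.
have [c1 c2] := ecvg_mull A (expm_cvg (t%:C *: A)) i j.
have e k : k.+1%:R * (k.+1)`!%:R^-1 = k`!%:R^-1 :> R.
  by rewrite factS natrM invfM mulVKf.
(* The factor [A] raises each power by one, which matches the index shift in [pseries_diffs]. *)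
have eS n : (A *m expm_sum (t%:C *: A) n) i j =
    \sum_(0 <= k < n) (t ^+ k / k`!%:R)%:C * (A ^+ k.+1) i j.
  rewrite /expm_sum mulmx_sumr summxE; apply: eq_bigr => k _.
  rewrite exprZmx scalerA -scalemxAr mxE factV_real -rmorphM mulrC.
  by rewrite exprS mulrC [_^-1 * _]mulrC.
split.
  rewrite (_ : (fun x => _) = fun x => limn (pseries (re_coef A i j) x)%classic).
    rewrite -(_ : limn (pseries (pseries_diffs (re_coef A i j)) t)%classic = Re _).
      exact: exp_bounded_derive.
    apply: cvg_lim; first exact: Rhausdorff.
    rewrite (_ : pseries _ t = fun n => Re ((A *m expm_sum (t%:C *: A) n) i j)) //.
    apply/funext => n; rewrite eS ?Re_sum ?Im_sum; apply: eq_bigr => k _.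
    by rewrite Re_realM /pseries_diffs /re_coef /= mulrCA e; ring.
  by apply/funext => x; rewrite expmZE mxE.
rewrite (_ : (fun x => _) = fun x => limn (pseries (im_coef A i j) x)%classic).
  rewrite -(_ : limn (pseries (pseries_diffs (im_coef A i j)) t)%classic = Im _).
    exact: exp_bounded_derive.
  apply: cvg_lim; first exact: Rhausdorff.
  rewrite (_ : pseries _ t = fun n => Im ((A *m expm_sum (t%:C *: A) n) i j)) //.
  apply/funext => n; rewrite eS ?Re_sum ?Im_sum; apply: eq_bigr => k _.
  by rewrite Im_realM /pseries_diffs /im_coef /= mulrCA e; ring.
by apply/funext => x; rewrite expmZE mxE.
Qed.

(* exp (- t A) exp (- t B) exp (t (A + B)) has derivative 0. *)
Lemma expmD A B : A *m B = B *m A -> expm (A + B) = expm A *m expm B.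
Proof.
move=> AB; pose E (C : 'M[R[i]]_m) (x : R) := expm (x%:C *: C).
have Ed C t : is_mderive (E C) t (C *m E C t) by exact: expm_derive.
have E0 C : E C 0 = 1%:M by rewrite /E scale0r expm0.
have E1 C : E C 1 = expm C by rewrite /E scale1r.
have EC C D t : C *m D = D *m C -> E C t *m D = D *m E C t.
  by move=> CD; apply: expm_intertwine; rewrite -scalemxAl CD scalemxAr.
have EV (C : 'M[R[i]]_m) : expm C *m expm (- C) = 1%:M.
  transitivity (E C 0 *m E (- C) 0); last by rewrite !E0 mulmx1.
  rewrite -(E1 C) -(E1 (- C)).
  apply: (@is_mderive0_cst _ _ _ (fun x => E C x *m E (- C) x)) => t.
  have := is_mderiveM (Ed C t) (Ed (- C) t); congr (is_mderive _ _ _).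
  by rewrite mulNmx mulmxN [E C t *m _]mulmxA (EC C C) // -mulmxA subrr.
pose S := A + B.
have H1 : expm (- A) *m expm (- B) *m expm S = 1%:M.
  transitivity (E (- A) 0 *m E (- B) 0 *m E S 0); last first.
    by rewrite !E0 !mulmx1.
  rewrite -(E1 (- A)) -(E1 (- B)) -(E1 S).
  apply: (@is_mderive0_cst _ _ _ (fun x => E (- A) x *m E (- B) x *m E S x)) => t.
  have := is_mderiveM (is_mderiveM (Ed (- A) t) (Ed (- B) t)) (Ed S t).
  congr (is_mderive _ _ _).
  have cA : E (- A) t *m A = A *m E (- A) t by apply: EC; rewrite mulNmx mulmxN.
  have cB : E (- B) t *m A = A *m E (- B) t by apply: EC; rewrite mulNmx mulmxN AB.
  have cBB : E (- B) t *m B = B *m E (- B) t by apply: EC; rewrite mulNmx mulmxN.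
  move: (E (- A) t) (E (- B) t) (E S t) cA cB cBB => U V W cA cB cBB.
  have -> : U *m V *m (S *m W) = (A *m U *m V + U *m (B *m V)) *m W.
    rewrite mulmxA; congr (_ *m W); rewrite mulmxDr.
    by rewrite -[U *m V *m A]mulmxA cB mulmxA cA -[U *m V *m B]mulmxA cBB.
  by rewrite !mulNmx mulmxN -opprD mulNmx addNr.
have -> : expm A *m expm B = expm B *m expm A.
  by apply/expm_intertwine/esym/expm_intertwine/esym.
rewrite -/S; move: (EV A) (EV B) H1.
move: (expm A) (expm (- A)) (expm B) (expm (- B)) (expm S) => U U' V V' W.
move=> UU' VV' H1; rewrite -[RHS]mulmx1 -H1 !mulmxA -[V *m U *m U']mulmxA.
by rewrite UU' mulmx1 VV' mul1mx.
Qed.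

Lemma expm_unit A : expm A \in unitmx.
Proof.
have : expm A *m expm (- A) = 1%:M.
  by rewrite -expmD ?subrr ?expm0 // mulmxN mulNmx.
by move=> /mulmx1_unit[h _]; exact: h.
Qed.

Lemma expm_opp A : expm (- A) = invmx (expm A).
Proof.
apply: (can_inj (mulKmx (expm_unit A))).
by rewrite mulmxV ?expm_unit // -expmD ?subrr ?expm0 // mulmxN mulNmx.
Qed.

End MatrixExponential.

Lemma det_colsE (R : realType) m p (a b : nat -> 'cV[R[i]]_m) :
  det_cols p a b = \det (cols (blk p a b)).
Proof.
by congr (\det _); apply/matrixP => i j; rewrite !mxE /blk; case: ifP.
Qed.

(** * The hyperbolic cotangent of a matrix *)

Section Coth.
Context {R : realType} {m : nat} (Gamma : 'M[R[i]]_m).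
Hypothesis hcoth : expm (2 *: Gamma) - 1%:M \in unitmx.
Local Notation A := (expm (2 *: Gamma)).
Local Notation K := (cothm Gamma).

Lemma cothmM : K *m (A - 1%:M) = A + 1%:M.
Proof. by rewrite /cothm -mulmxA mulVmx // mulmx1. Qed.

Lemma cothmE : K = (A + 1%:M) *m invmx (A - 1%:M).
Proof. by []. Qed.

Lemma comm_cothm (P : 'M[R[i]]_m) : A *m P = P *m A -> K *m P = P *m K.
Proof.
move=> AP; apply: (can_inj (mulmxK hcoth)).
have -> : K *m P *m (A - 1%:M) = K *m (A - 1%:M) *m P.
  by rewrite -!mulmxA mulmxBr mulmxBl AP mulmx1 mul1mx.
by rewrite -[P *m K *m _]mulmxA cothmM mulmxDl mulmxDr AP mulmx1 mul1mx.
Qed.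

(** coth is odd, so it inherits the intertwining relation of [Gamma] with the same sign. The claim
    is checked after multiplication by the invertible conjugate of [A - 1]. *)
Lemma cothm_conj (sigma : int) (T : 'M[R[i]]_m) : sigma = 1 \/ sigma = -1 ->
    T *m conj_mx Gamma = - sigma%:~R *: Gamma *m T ->
  T *m conj_mx K = - sigma%:~R *: K *m T.
Proof.
move=> hs TG.
have TA : T *m conj_mx A = expm (- sigma%:~R *: (2 *: Gamma)) *m T.
  rewrite expm_conj; apply/esym/expm_intertwine.
  rewrite /conj_mx map_mxZ rmorph_nat -scalemxAr TG.
  by rewrite -!scalemxAl !scalerA mulrC.
have unitC : conj_mx A - 1%:M \in unitmx.
  have -> : conj_mx A - 1%:M = conj_mx (A - 1%:M).
    by rewrite /conj_mx map_mxB map_mx1.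
  by rewrite /conj_mx map_unitmx.
have KC : conj_mx K *m (conj_mx A - 1%:M) = conj_mx A + 1%:M.
  have := congr1 (@conj_mx _ _ _) cothmM.
  by rewrite /conj_mx map_mxM map_mxB map_mxD map_mx1.
apply: (can_inj (mulmxK unitC)).
rewrite -mulmxA KC -[_ *m T *m _]mulmxA mulmxDr mulmxBr TA mulmx1.
(* The exponential in [TA] is [A] itself for sigma = -1, and its inverse for sigma = 1. *)
case: hs => ->; rewrite ?mulr1z ?mulrN1z ?opprK ?scale1r ?scaleN1r; last first.
  rewrite -[X in _ = K *m (_ - X)]mul1mx -mulmxBl mulmxA cothmM.
  by rewrite mulmxDl mul1mx.
rewrite expm_opp mulNmx -mulmxN opprB -[X in _ = K *m (X - _)]mul1mx -mulmxBl.
have -> : 1%:M - invmx A = (A - 1%:M) *m invmx A.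
  by rewrite mulmxBl mulmxV ?expm_unit // mul1mx.
rewrite !mulmxA cothmM mulmxDl mulmxV ?expm_unit // mul1mx mulmxDl mul1mx.
by rewrite addrC.
Qed.

End Coth.

#[local] Opaque expm cothm.

(** * The double Casoratian solution *)

Lemma comm_scale (F : comNzRingType) m (a b : F) (X Y : 'M[F]_m) :
  X *m Y = Y *m X -> (a *: X) *m (b *: Y) = (b *: Y) *m (a *: X).
Proof. by move=> XY; rewrite -!scalemxAl -!scalemxAr XY !scalerA mulrC. Qed.

Section Solution.
Context {R : realType} (N : nat) (eps : R).
Local Notation m := (2 * N.+1)%N.
Context (Gamma T : 'M[R[i]]_m) (Cp : 'cV[R[i]]_m).
Hypothesis hcoth : expm (2 *: Gamma) - 1%:M \in unitmx.

Local Notation K := (cothm Gamma).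
Local Notation kap := ((eps / 4)%:C).

Let GK : Gamma *m K = K *m Gamma.
Proof.
apply/esym/comm_cothm => //; apply: expm_intertwine.
by rewrite -scalemxAl -scalemxAr.
Qed.

Definition dexp (z : int) : 'M[R[i]]_m := expm (z%:~R *: Gamma).

Lemma dexpD x y : dexp (x + y) = dexp x *m dexp y.
Proof.
by rewrite /dexp intrD scalerDl expmD //; apply: comm_scale.
Qed.

Lemma dexp_unit z : dexp z \in unitmx. Proof. exact: expm_unit. Qed.

Definition phase (t : R) : 'cV[R[i]]_m := expm (t%:C *: (kap *: K)) *m Cp.
Definition cophase (t : R) : 'cV[R[i]]_m :=
  expm (t%:C *: (- kap *: K)) *m (T *m conj_mx Cp).

Definition acol (z : int) (t : R) := dexp z *m phase t.
Definition bcol (z : int) (t : R) := dexp z *m cophase t.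

Lemma dexp_acol x z t : dexp x *m acol z t = acol (x + z) t.
Proof. by rewrite /acol dexpD -mulmxA. Qed.

Lemma dexp_bcol x z t : dexp x *m bcol z t = bcol (x + z) t.
Proof. by rewrite /bcol dexpD -mulmxA. Qed.

(** The offsets combine the powers E^(-N) and E^N of the leading columns with the opposite flows E^n
    and E^(-n) of the two blocks. *)
Definition tau (p : nat) (n : int) (t : R) : R[i] :=
  casorati (acol^~ t) (bcol^~ t) p (n - N%:Z) (N%:Z - n).

Lemma det_dexp_neq0 z : \det (dexp z) != 0.
Proof. by have := dexp_unit z; rewrite unitmxE unitfE. Qed.

Lemma det_dexp2 : \det (dexp 2) = \det (dexp 1) ^+ 2.
Proof. by rewrite -[2]/(1 + 1 : int) dexpD det_mulmx. Qed.

Lemma dexp2E : dexp 2 = expm (2 *: Gamma).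
Proof. by rewrite /dexp; congr (expm (_ *: _)). Qed.

Lemma K_dexp z : K *m dexp z = dexp z *m K.
Proof.
apply/esym/expm_intertwine.
by rewrite -scalemxAl GK scalemxAr.
Qed.

Lemma acol_derive z t : is_mderive (acol z) t (kap *: (K *m acol z t)).
Proof.
have := is_mderive_mull (dexp z) (is_mderive_mulr Cp (expm_derive (kap *: K) t)).
congr (is_mderive _ _ _); rewrite /acol /phase.
move: (expm _) => W; rewrite -!scalemxAl -scalemxAr; congr (_ *: _).
by rewrite [RHS]mulmxA K_dexp -!mulmxA.
Qed.

Lemma bcol_derive z t : is_mderive (bcol z) t (- kap *: (K *m bcol z t)).
Proof.
have := is_mderive_mull (dexp z)
  (is_mderive_mulr (T *m conj_mx Cp) (expm_derive (- kap *: K) t)).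
congr (is_mderive _ _ _); rewrite /bcol /cophase.
move: (expm _) => W; rewrite -!scalemxAl -scalemxAr; congr (_ *: _).
by rewrite [RHS]mulmxA K_dexp -!mulmxA.
Qed.

Hypothesis heps : eps != 0.
Hypothesis hF : forall n t, tau N.+1 n t != 0.

Lemma tau_toda n t :
  tau N.+1 (n + 1) t * tau N.+1 (n - 1) t - tau N.+1 n t ^+ 2 =
  tau N.+2 n t * tau N n t.
Proof.
have := @casorati_toda _ _ dexp (acol^~ t) (bcol^~ t)
  (fun x z => dexp_acol x z t) (fun x z => dexp_bcol x z t)
  det_dexp_neq0 det_dexp2 _ _ (hF n t).
rewrite -!addrA ![- N%:Z + _]addrC !addrA.
have -> : N%:Z - n - 1 = N%:Z - (n + 1) by ring.
by have -> : N%:Z - n + 1 = N%:Z - (n - 1) by ring.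
Qed.

(** * Time evolution of the coordinates *)

Section Time.
Context (n : int).

Local Notation x0 := (n - N%:Z).
Local Notation y0 := (N%:Z - n).
Local Notation X t := (cols (blk N.+1 (aseq (acol^~ t) x0) (bseq (bcol^~ t) y0))).
Definition coords (t : R) : 'cV[R[i]]_m :=
  coord (acol^~ t) (bcol^~ t) x0 y0 (aseq (acol^~ t) x0 N.+1).

Lemma X_derive t : is_mderive (fun t => X t) t
  (cols (blk N.+1 (fun j => kap *: (K *m aseq (acol^~ t) x0 j))
                  (fun j => - kap *: (K *m bseq (bcol^~ t) y0 j)))).
Proof.
move=> i j; rewrite mxE /blk.
case: ifP => hj.
  apply: is_cderive_ext (acol_derive _ t i ord0) => s.
  by rewrite [RHS]mxE hj.
apply: is_cderive_ext (bcol_derive _ t i ord0) => s.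
by rewrite [RHS]mxE hj.
Qed.

(** The identity is the product rule for X times [coords], whose product is the column a_(N+1) with
    known derivative. *)
Lemma coords_derive t : exists coords', is_mderive coords t coords' /\
  X t *m coords' + cols (blk N.+1 (fun j => kap *: (K *m aseq (acol^~ t) x0 j))
      (fun j => - kap *: (K *m bseq (bcol^~ t) y0 j))) *m coords t =
  kap *: (K *m aseq (acol^~ t) x0 N.+1).
Proof.
have Xu s : X s \in unitmx by apply: casorati_unit; exact: hF.
have ad : is_mderive (fun s => aseq (acol^~ s) x0 N.+1) t
    (kap *: (K *m aseq (acol^~ t) x0 N.+1)) by exact: acol_derive.
have e s : X s *m coords s = aseq (acol^~ s) x0 N.+1.
  by apply/esym/coordK; exact: hF.
have [Y' hY] := mderive_invmx Xu (X_derive t).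
have [coords' hb] : exists coords', is_mderive coords t coords'.
  by eexists; exact: (is_mderiveM hY ad).
exists coords'; split; first exact: hb.
rewrite addrC.
exact: (is_mderive_unique (is_mderive_ext e (is_mderiveM (X_derive t) hb)) ad).
Qed.

Local Notation sgn := ((-1) ^+ N : R[i]).
Local Notation dE := (\det (dexp 1)).

Lemma tau_next t :
  dE * tau N.+1 (n + 1) t = sgn * (coords t col0 ord0 * tau N.+1 n t).
Proof.
have := @casorati_next _ _ dexp (acol^~ t) (bcol^~ t)
  (fun x z => dexp_acol x z t) (fun x z => dexp_bcol x z t) _ _ (hF n t).
have -> : x0 + 1 = n + 1 - N%:Z by ring.
by have -> : y0 - 1 = N%:Z - (n + 1) by ring.
Qed.

Lemma tau_grow t : tau N.+2 n t = sgn * (coords t collast ord0 * tau N.+1 n t).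
Proof. exact: (casorati_grow (hF n t)). Qed.

Lemma tau_grow_next t : tau N.+2 (n + 1) t = dE * (coords t colN ord0 * tau N.+1 n t).
Proof.
have := @casorati_grow_next _ _ dexp (acol^~ t) (bcol^~ t)
  (fun x z => dexp_acol x z t) (fun x z => dexp_bcol x z t) _ _ (hF n t).
have -> : x0 + 1 = n + 1 - N%:Z by ring.
by have -> : y0 - 1 = N%:Z - (n + 1) by ring.
Qed.

Lemma coords_first_neq0 t : coords t col0 ord0 != 0.
Proof.
have : dE * tau N.+1 (n + 1) t != 0.
  by rewrite mulf_eq0 negb_or det_dexp_neq0 hF.
by rewrite tau_next !mulf_eq0 !negb_or => /and3P[].
Qed.

Definition res_coords (t : R) := coord (acol^~ t) (bcol^~ t) x0 y0
  (useq dexp (acol^~ t) x0 1).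

Lemma res_coords_mid t : dE ^+ 2 * res_coords t colN ord0 =
  coords t col0 ord0 * res_coords t collast ord0 -
  coords t collast ord0 * res_coords t col0 ord0.
Proof.
apply: (@coord_mid _ _ dexp (acol^~ t) (bcol^~ t)
  (fun x z => dexp_acol x z t) (fun x z => dexp_bcol x z t)
  det_dexp2 _ _ (hF n t)).
by rewrite dexp2E.
Qed.

Lemma coords_riccati t : exists L : R[i],
  [/\ is_cderive (fun s => coords s col0 ord0) t
        (2 * kap * (2 * coords t col0 ord0 + 2 * res_coords t col0 ord0 * L)),
      is_cderive (fun s => coords s colN ord0) t
        (2 * kap * (coords t colN ord0 + 2 * res_coords t colN ord0 * L)) &
      is_cderive (fun s => coords s collast ord0) t
        (2 * kap * (coords t collast ord0 + 2 * res_coords t collast ord0 * L))].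
Proof.
have [coords' [hb ode]] := coords_derive t.
have QU : dexp 2 - 1%:M \in unitmx by rewrite dexp2E.
have KE : K = (dexp 2 + 1%:M) *m invmx (dexp 2 - 1%:M) by rewrite dexp2E cothmE.
have entryE := @coord_aseq_derivative _ _ dexp (acol^~ t) (bcol^~ t)
  (fun x z => dexp_acol x z t) _ _ (hF n t) QU _ _ _ _ KE ode.
exists (1 - \sum_(j < m | (j < N.+1)%N) coords t j ord0); split.
- by have := hb col0 ord0; rewrite entryE.
- have := hb colN ord0; rewrite entryE //; last exact: ltnSn.
  by rewrite /= addr0 mul1r.
- have := hb collast ord0; rewrite entryE //; last by rewrite /=; lia.
  by rewrite /= addr0 mul1r.
Qed.

End Time.

Context (omega : int -> R -> R[i]).
Hypothesis omega_diff : forall n t, cderivable (omega n) t.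
Hypothesis omegaE : forall n t,
  cexp (eps%:C * omega n t) = tau N.+1 (n + 1) t / tau N.+1 n t.

Local Notation mu n t := (eps%:C^-1 * tau N.+2 n t / tau N.+1 n t).

Let epsC0 : eps%:C != 0 :> R[i].
Proof. by rewrite fmorph_eq0. Qed.

Local Notation sgn := ((-1) ^+ N : R[i]).
Local Notation dE := (\det (dexp 1)).

Lemma mu_coords n t : mu n t = sgn / eps%:C * coords n t collast ord0.
Proof.
have := hF n t; rewrite tau_grow; move: (tau N.+1 n t) (coords _ _ _ _) => f b f0.
by field; rewrite epsC0 f0.
Qed.

Lemma mu_next_coords n t : mu (n + 1) t =
  sgn * dE ^+ 2 / eps%:C * (coords n t colN ord0 / coords n t col0 ord0).
Proof.
have e1 := tau_next n t; have e2 := tau_grow_next n t.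
have f0 := hF n t; have b0 := coords_first_neq0 n t; have d0 := det_dexp_neq0 1.
have ss : sgn * sgn = 1 by rewrite -expr2 sqrr_sign.
exact: (div_casorati epsC0 d0 f0 b0 ss e1 e2).
Qed.

Lemma omega_coords n t : cexp (eps%:C * omega n t) = sgn / dE * coords n t col0 ord0.
Proof.
rewrite omegaE; have e1 := tau_next n t.
have f0 := hF n t; have d0 := det_dexp_neq0 1.
exact: (div_next d0 f0 e1).
Qed.

Lemma sdsG_derivative n t :
  [/\ cderivable (fun s => mu n s) t &
   2 * cderive (fun s => mu (n + 1) s - mu n s) t
     = eps%:C * (mu n t + mu (n + 1) t) * (1 - 2 * cderive (omega n) t)].
Proof.
have [L [dq dr dp]] := coords_riccati n t.
have q0 := coords_first_neq0 n t; have d0 := det_dexp_neq0 1.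
have dmu := is_cderiveZ (sgn / eps%:C) dp.
have dmu1 := is_cderiveZ (sgn * dE ^+ 2 / eps%:C) (is_cderive_div q0 dr dq).
split; first by have [] := is_cderive_val (is_cderive_ext (fun s => esym (mu_coords n s)) dmu).
have ddiff := is_cderiveD dmu1 (is_cderiveZ (-1) dmu).
have ediff s : sgn * dE ^+ 2 / eps%:C * (coords n s colN ord0 / coords n s col0 ord0) +
    -1 * (sgn / eps%:C * coords n s collast ord0) = mu (n + 1) s - mu n s.
  by rewrite mulN1r -mu_coords -mu_next_coords.
have [_ ->] := is_cderive_val (is_cderive_ext ediff ddiff).
have dw := cderivableP (omega_diff n t).
(* The exponential of eps omega is differentiated in two ways, directly and through the first
   coordinate; comparing them determines omega'. *)
have dcexp := is_cderive_cexp (is_cderiveZ eps%:C dw).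
have dcexp' := is_cderive_ext (fun s => esym (omega_coords n s)) (is_cderiveZ (sgn / dE) dq).
have := is_cderive_unique dcexp dcexp'; rewrite omega_coords.
move: (cderive (omega n) t) => w' ew.
have kap4 : eps%:C = 4 * kap.
  by rewrite rmorphM fmorphV rmorph_nat mulrC mulfVK ?pnatr_eq0.
have := riccati_sdsG sgn (coords n t colN ord0) L epsC0 (expf_neq0 2 d0) q0 kap4
  (res_coords_mid n t).
have c0 : sgn / dE != 0 by rewrite mulf_eq0 negb_or signr_eq0 invr_eq0.
move=> ric; rewrite mulN1r; apply: (etrans ric).
exact: (f_equal2 (fun x w => eps%:C * x * (1 - 2 * w))
  (f_equal2 +%R (esym (mu_coords n t)) (esym (mu_next_coords n t)))
  (log_derivative epsC0 c0 q0 ew)).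
Qed.

(** * Conjugation, reflection and the second equation *)

Context (sigma : int).
Hypothesis hsigma : sigma = 1 \/ sigma = -1.
Hypothesis hGT : Gamma *m T + sigma%:~R *: (T *m conj_mx Gamma) = 0.

Let sigma2 : sigma * sigma = 1.
Proof. by case: hsigma => ->. Qed.

Let TG : T *m conj_mx Gamma = - sigma%:~R *: Gamma *m T.
Proof.
have /(congr1 (fun M => sigma%:~R *: M)) := hGT.
rewrite scaler0 scalerDr scalerA -intrM sigma2 scale1r => /eqP.
by rewrite addrC addr_eq0 -scaleNr => /eqP ->; rewrite scalemxAl.
Qed.

Let exponentE (x : R) : (eps / 4 * x)%:C *: K = x%:C *: (kap *: K).
Proof. by rewrite scalerA -rmorphM mulrC. Qed.

Let GKZ (x y z : R[i]) :
  (x *: Gamma) *m (y *: (z *: K)) = (y *: (z *: K)) *m (x *: Gamma).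
Proof. by rewrite scalerA; apply: comm_scale. Qed.

Lemma PhiE n t : Phi eps Gamma Cp n t = acol n t.
Proof. by rewrite /Phi exponentE (expmD (GKZ _ _ _)) -mulmxA. Qed.

(** Passing [T] multiplies the exponent by - sigma, and the reflected arguments contribute another
    sigma; the total factor is -1 in both cases. *)
Lemma TPhiE n t : TPhi sigma eps Gamma T Cp n t = bcol (- n) t.
Proof.
have TK := cothm_conj hcoth hsigma TG.
have e : T *m conj_mx (expm ((sigma * n)%:~R *: Gamma +
      (sigma%:~R * t)%:C *: (kap *: K))) =
    expm ((- n)%:~R *: Gamma + t%:C *: (- kap *: K)) *m T.
  rewrite expm_conj; apply/esym/expm_intertwine.
  rewrite mulmxDl /conj_mx map_mxD !map_mxZ -/(conj_mx Gamma) -/(conj_mx K).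
  rewrite mulmxDr -!scalemxAr TG TK -!scalemxAl !scalerA.
  have conj_int (z : int) : conjc (z%:~R : R[i]) = z%:~R by rewrite rmorph_int.
  have conj_real (x : R) : conjc x%:C = x%:C by rewrite /= oppr0.
  have real_int (z : int) : (z%:~R : R)%:C = z%:~R by rewrite rmorph_int.
  have s2 : sigma%:~R * sigma%:~R = 1 :> R[i] by rewrite -intrM sigma2.
  rewrite [X in X *: _ + _ = _](_ : _ = conjc (sigma * n)%:~R * - sigma%:~R).
    rewrite [X in _ + X *: _ = _](_ : _ =
      conjc (sigma%:~R * t)%:C * conjc kap * - sigma%:~R) //.
    have realM (x y : R) : (x * y)%:C = x%:C * y%:C by rewrite rmorphM.
    rewrite !conj_real (realM sigma%:~R) real_int.
    by rewrite -[LHS]mul1r -[X in X * _ = _]s2; ring.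
  by rewrite conj_int intrM mulrN mulrAC s2 mul1r mulrNz.
rewrite /TPhi /Phi exponentE /conj_mx map_mxM -/(conj_mx _) -/(conj_mx Cp).
have {}e := etrans e (congr1 (mulmx^~ T) (expmD (GKZ (- n)%:~R t%:C (- kap)))).
rewrite /bcol /cophase /dexp.
move: e; move: (conj_mx (expm _)) (expm (_ *: Gamma)) (expm (t%:C *: _)).
by move=> U V W e; rewrite mulmxA e -!mulmxA.
Qed.

Lemma det_cols_tau p n t :
  det_cols p
    (fun j => expm (((2 * j)%:Z - N%:Z)%:~R *: Gamma) *m Phi eps Gamma Cp n t)
    (fun j => expm ((N%:Z - (2 * j)%:Z)%:~R *: Gamma)
              *m TPhi sigma eps Gamma T Cp n t) = tau p n t.
Proof.
rewrite /tau /casorati det_colsE; apply: congr1; apply: eq_blk => j _.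
  rewrite PhiE -/(dexp _) dexp_acol /aseq.
  by apply: (congr1 (acol^~ t)); ring.
rewrite TPhiE -/(dexp _) dexp_bcol /bseq.
by apply: (congr1 (bcol^~ t)); ring.
Qed.

Lemma fsolE n t : fsol sigma eps Gamma T Cp n t = tau N.+1 n t.
Proof. exact: det_cols_tau. Qed.

Lemma gsolE n t : gsol sigma eps Gamma T Cp n t = eps%:C^-1 * tau N.+2 n t.
Proof. by rewrite /gsol det_cols_tau. Qed.

Lemma T_conj_acol z t :
  T *m conj_mx (acol z (sigma%:~R * t)) = bcol (- (sigma * z)) t.
Proof.
by rewrite -TPhiE /TPhi PhiE mulrA sigma2 mul1r.
Qed.

Lemma T_conj_bcol c z t : T *m conj_mx T = c *: 1%:M ->
  T *m conj_mx (bcol z (sigma%:~R * t)) = c *: acol (- (sigma * z)) t.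
Proof.
move=> TT; rewrite -[z]opprK -TPhiE /TPhi PhiE /conj_mx map_mxM -/(conj_mx T).
rewrite mulmxA TT -scalemxAl mul1mx mulrA -intrM sigma2 mul1r; congr (_ *: _).
rewrite -map_mx_comp map_mx_id => [|x]; last exact: conjcK.
by rewrite opprK mulrN.
Qed.

Lemma det_T_conj c p n t : T *m conj_mx T = c *: 1%:M ->
  \det T * conjc (tau p (sigma * n) (sigma%:~R * t)) =
  \det (cols (blk p
    (fun j => bcol (- (sigma * (sigma * n - N%:Z + (2 * j)%N%:Z))) t)
    (fun j => c *: acol (- (sigma * (N%:Z - sigma * n - (2 * j)%N%:Z))) t))).
Proof.
move=> TT; rewrite /tau /casorati -det_map_mx -det_mulmx; congr (\det _).
have -> : map_mx (@conjc R) (cols (blk p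
      (aseq (acol^~ (sigma%:~R * t)) (sigma * n - N%:Z))
      (bseq (bcol^~ (sigma%:~R * t)) (N%:Z - sigma * n)))) =
    cols (blk p
      (fun j => conj_mx (acol (sigma * n - N%:Z + (2 * j)%N%:Z) (sigma%:~R * t)))
      (fun j => conj_mx (bcol (N%:Z - sigma * n - (2 * j)%N%:Z) (sigma%:~R * t)))).
  apply/matrixP => i j; rewrite !mxE /blk /aseq /bseq /conj_mx.
  by case: ifP => _; rewrite [RHS]mxE.
rewrite mulmx_blk; apply: eq_blk => j _; first exact: T_conj_acol.
exact: T_conj_bcol.
Qed.

Context (eta : int).
Hypothesis heta : eta = 1 \/ eta = -1.
Hypothesis hTT : T *m conj_mx T =
  if sigma == 1 then - (eta%:~R *: 1%:M)
  else (eta%:~R * \det (expm (conj_mx Gamma)) ^+ 2) *: 1%:M.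

(** A common [k] for both determinants is the point: it cancels in their ratio, leaving only the
    factor eta. *)
Lemma tau_conj n t : exists2 k : R[i], k != 0 &
  \det T * conjc (tau N.+1 (sigma * n) (sigma%:~R * t)) = k * tau N.+1 n t /\
  \det T * conjc (tau N.+2 (sigma * n) (sigma%:~R * t)) =
    eta%:~R * k * tau N n t.
Proof.
have eta2 : eta%:~R * eta%:~R = 1 :> R[i].
  by rewrite -intrM; case: heta => ->.
have eta0 : eta%:~R != 0 :> R[i].
  by case: heta => ->; rewrite ?mulrN1z ?oppr_eq0 oner_eq0.
case: hsigma => sE.
  have TT : T *m conj_mx T = - eta%:~R *: 1%:M by rewrite hTT sE eqxx scaleNr.
  have conjE (p : nat) : (p <= m)%N ->
      \det T * conjc (tau p (sigma * n) (sigma%:~R * t)) =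
      eta%:~R ^+ (m - p) * tau (m - p) n t.
    move=> lepm; apply: (etrans (det_T_conj _ _ _ TT)).
    have := @casorati_swap _ _ (acol^~ t) (bcol^~ t) (- eta%:~R) p
      (n - N%:Z) (N%:Z - n) lepm.
    rewrite opprK => /(etrans _); apply.
    apply: congr1; apply: eq_blk => j _; rewrite sE /bseq /aseq.
      by apply: (congr1 (bcol^~ t)); ring.
    by apply: congr1; apply: (congr1 (acol^~ t)); ring.
  (* The factor is eta^(m - p): eta^(N+1) for p = N+1, and eta^N = eta * eta^(N+1) for p = N+2. *)
  exists (eta%:~R ^+ N.+1); first exact: expf_neq0.
  split; rewrite conjE; try lia.
    by have -> : (m - N.+1 = N.+1)%N by lia.
  have -> : (m - N.+2 = N)%N by lia.
  by rewrite exprS mulrA eta2 mul1r.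
have TT : T *m conj_mx T = (eta%:~R * \det (expm (conj_mx Gamma)) ^+ 2) *: 1%:M.
  by rewrite hTT sE.
set c := eta%:~R * _ in TT.
have c0 : c != 0.
  have := expm_unit (conj_mx Gamma); rewrite unitmxE unitfE => d0.
  by rewrite mulf_eq0 negb_or eta0 expf_neq0.
have detT0 : \det T != 0.
  have := congr1 determinant TT; rewrite det_mulmx detZ det1 mulr1 => e.
  have : c ^+ m != 0 by exact: expf_neq0.
  by rewrite -e mulf_eq0 negb_or => /andP[].
(* For sigma = -1 the invertible [T] makes [Gamma] similar to its conjugate, so their exponentials
   have equal determinants. *)
have cE : c = eta%:~R * \det (dexp 1) ^+ 2.
  have e : expm Gamma *m T = T *m expm (conj_mx Gamma).
    by apply: expm_intertwine; rewrite TG sE mulrN1z opprK scale1r.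
  have := congr1 determinant e; rewrite !det_mulmx [RHS]mulrC => /(mulIf detT0) d.
  have -> : dexp 1 = expm Gamma by rewrite /dexp mulr1z scale1r.
  exact: (congr1 (fun z => eta%:~R * z ^+ 2) (esym d)).
set r : R[i] := (-1) ^+ perm (@rev_ord_inj m).
have conjE (p : nat) : (0 < p <= m)%N ->
    \det T * conjc (tau p (sigma * n) (sigma%:~R * t)) =
    r * (c ^+ (m - p) * casorati (acol^~ t) (bcol^~ t) (m - p)
      (N%:Z + n - (2 * m)%N%:Z + (2 * p.+1)%N%:Z) (- n - N%:Z + (2 * p.-1)%N%:Z)).
  move=> hp; apply: (etrans (det_T_conj _ _ _ TT)).
  have := @casorati_rev _ _ (acol^~ t) (bcol^~ t) c p
      (N%:Z + n) (- n - N%:Z) hp.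
  apply: etrans.
  apply: congr1; apply: eq_blk => j _; rewrite sE.
    by apply: (congr1 (bcol^~ t)); ring.
  by apply: congr1; apply: (congr1 (acol^~ t)); ring.
have r0 : r != 0 by rewrite /r signr_eq0.
clearbody c r; exists (r * c ^+ N.+1).
  by rewrite mulf_eq0 negb_or r0 expf_neq0.
split; rewrite conjE; try lia.
  have -> : (m - N.+1 = N.+1)%N by lia.
  rewrite mulrA /tau; have -> : N%:Z + n - (2 * m)%N%:Z + (2 * N.+2)%N%:Z = n - N%:Z by lia.
  by have -> : - n - N%:Z + (2 * N.+1.-1)%N%:Z = N%:Z - n by lia.
have -> : (m - N.+2 = N)%N by lia.
(* For p = N+2 the reversed columns carry an extra E^2. Its determinant equals eta c and supplies
   the power of [c] that is missing from c^N; this is where the squared determinant in the condition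
   on [T] is needed. *)
have -> : N%:Z + n - (2 * m)%N%:Z + (2 * N.+3)%N%:Z = n - N%:Z + 2 by lia.
have -> : - n - N%:Z + (2 * N.+2.-1)%N%:Z = N%:Z - n + 2 by lia.
have := @casorati_shift _ _ dexp (acol^~ t) (bcol^~ t)
  (fun x z => dexp_acol x z t) (fun x z => dexp_bcol x z t)
  N (n - N%:Z) (N%:Z - n) 2.
rewrite -/(tau N n t) => <-; rewrite det_dexp2.
have -> : \det (dexp 1) ^+ 2 = eta%:~R * c by rewrite cE mulrA eta2 mul1r.
by rewrite exprS; ring.
Qed.

Lemma tau_conj_ratio n t :
  conjc (tau N.+2 (sigma * n) (sigma%:~R * t) /
         tau N.+1 (sigma * n) (sigma%:~R * t)) =
  eta%:~R * (tau N n t / tau N.+1 n t).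
Proof.
have [k k0 [e1 e2]] := tau_conj n t.
have f0 := hF n t.
have divJ (u v : R[i]) : conjc (u / v) = conjc u / conjc v by exact: fmorph_div.
rewrite divJ; exact: (div_proportional k0 f0 e1 e2).
Qed.

Lemma sdsG_algebraic n t :
  cexp (eps%:C * (omega n t - omega (n - 1) t)) - 1 =
  eta%:~R * eps%:C ^+ 2 * mu n t * conjc (mu (sigma * n) (sigma%:~R * t)).
Proof.
rewrite mulrBr cexpB !omegaE subrK.
have eta2 : eta%:~R * eta%:~R = 1 :> R[i].
  by rewrite -intrM; case: heta => ->.
have -> : conjc (mu (sigma * n) (sigma%:~R * t)) =
    eps%:C^-1 * (eta%:~R * (tau N n t / tau N.+1 n t)).
  rewrite -tau_conj_ratio -mulrA (rmorphM (@conjc R)) (fmorphV (@conjc R)).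
  by rewrite /= oppr0.
exact: (div_toda epsC0 (hF n t) (hF (n - 1) t) eta2 (tau_toda n t)).
Qed.

End Solution.

Theorem theorem9 (R : realType) (eta sigma : int) (N : nat) (eps : R)
    (Gamma T : 'M[R[i]]_(2 * N.+1)) (Cp : 'cV[R[i]]_(2 * N.+1))
    (omega : int -> R -> R[i])
    (heta : eta = 1 \/ eta = -1)
    (hsigma : sigma = 1 \/ sigma = -1)
    (heps : eps != 0)
    (hGT : Gamma *m T + sigma%:~R *: (T *m conj_mx Gamma) = 0)
    (hTT : T *m conj_mx T =
           if sigma == 1 then - (eta%:~R *: 1%:M)
           else (eta%:~R * \det (expm (conj_mx Gamma)) ^+ 2) *: 1%:M)
    (hcoth : expm (2 *: Gamma) - 1%:M \in unitmx)
    (hf : forall (n : int) (t : R), fsol sigma eps Gamma T Cp n t != 0)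
    (homega_diff : forall (n : int) (t : R), cderivable (omega n) t)
    (homega : forall (n : int) (t : R),
       cexp (eps%:C * omega n t)
       = fsol sigma eps Gamma T Cp (n + 1) t / fsol sigma eps Gamma T Cp n t) :
  solves_sdsG eta sigma eps
    (fun n t => gsol sigma eps Gamma T Cp n t / fsol sigma eps Gamma T Cp n t)
    omega.
Proof.
have fE := fsolE eps Cp hcoth hsigma hGT.
have gE := gsolE eps Cp hcoth hsigma hGT.
have hF n t : tau eps Gamma T Cp N.+1 n t != 0 by rewrite -fE.
have omegaE n t : cexp (eps%:C * omega n t) =
    tau eps Gamma T Cp N.+1 (n + 1) t / tau eps Gamma T Cp N.+1 n t.
  by rewrite homega !fE.
have -> : (fun n t => gsol sigma eps Gamma T Cp n t / fsol sigma eps Gamma T Cp n t) =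
    (fun n t => eps%:C^-1 * tau eps Gamma T Cp N.+2 n t / tau eps Gamma T Cp N.+1 n t).
  by apply/funext => n; apply/funext => t; rewrite fE gE.
move=> n t.
have [dmu eq1] := sdsG_derivative hcoth heps hF homega_diff omegaE n t.
split; [exact: dmu | exact: homega_diff | exact: eq1 |].
exact: (sdsG_algebraic hcoth heps hF omegaE hsigma hGT heta hTT).
Qed.
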